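(* The loop graph functor $\Omega\colon\mathsf{Graph}_*\to\mathsf{Graph}_*$ is exact, i.e. it preserves fibrations, acyclic fibrations, pullbacks along fibrations, and the terminal object.
   Context: Graphs. A graph is a (possibly infinite) simple undirected graph without loops; write $v\sim w$ if $v,w$ are equal or joined by an edge. A graph map $f\colon G\to H$ is a function on vertices such that $v\sim w$ implies $f(v)\sim f(w)$. The product $G\otimes H$ has as vertices the pairs $(v,w)$, with $(v,w)\sim(v',w')$ iff ($v=v'$ and $w\sim w'$) or ($w=w'$ and $v\sim v'$); $G^{\otimes n}$ is the $n$-fold product, and $G^{\otimes 0}$ is the one-vertex graph. $I_m$ has vertices $0,\dots,m$ and edges between $i$ and $i+1$; $I_\infty$ has vertex set $\mathbb{Z}$ and edges between $i$ and $i+1$. $\mathsf{Graph}_*$ is the category of pointed graphs (graphs with a chosen vertex) and basepoint-preserving graph maps. Loop graph. $\operatorname{hom}^{\otimes}(G,H)$ is the graph whose vertices are graph maps $G\to H$, with $f\sim g$ iff there is a graph map $G\otimes I_1\to H$ restricting to $f$ on $G\otimes\{0\}$ and to $g$ on $G\otimes\{1\}$. The path graph $PG$ is the induced subgraph of $\operatorname{hom}^{\otimes}(I_\infty,G)$ on those $p\colon I_\infty\to G$ which are eventually constant in both the negative and positive directions; the eventual values are its left and right endpoints. For a pointed graph $(G,v)$, $\Omega(G,v)$ is the (induced) subgraph of $PG$ of paths with both endpoints $v$ (the pullback of $PG\to G\times G$ along $(v,v)\colon I_0\to G\times G$), pointed by the constant path at $v$; $\Omega$ acts on maps by postcomposition.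 A-groups. $A_0(G)$ is the set of connected components of $G$. For $n\ge1$, $A_n(G,v)$ is the group (under concatenation) of based homotopy classes of graph maps $f\colon I_\infty^{\otimes n}\to G$ for which there is $M\ge0$ with $f(v_1,\dots,v_n)=v$ whenever some $|v_i|\ge M$; a based homotopy from $f$ to $g$ is a graph map $I_\infty^{\otimes n}\otimes I_m\to G$ (some $m\ge0$) restricting to $f$ and $g$ at the ends $0,m$ of $I_m$ and equal to $v$ at all $(v_1,\dots,v_n,t)$ with some $|v_i|\ge K$, for some $K$. Cubical sets. The box category $\square$ has objects the posets $[1]^n=\{0\le1\}^n$, $n\ge0$, with morphisms generated by: faces $\partial_{i,\varepsilon}\colon[1]^{n-1}\to[1]^n$ inserting $\varepsilon\in\{0,1\}$ in position $i$; degeneracies $\sigma_i\colon[1]^n\to[1]^{n-1}$ deleting the $i$-th coordinate; connections $\gamma_{i,0},\gamma_{i,1}\colon[1]^n\to[1]^{n-1}$ replacing $x_i,x_{i+1}$ by their max and min respectively. A cubical set is a presheaf on $\square$, with operators acting on the right. $\square^n$ is the representable presheaf of $[1]^n$; the open box $\sqcap^n_{i,\varepsilon}\subseteq\square^n$ ($n\ge1$, $1\le i\le n$) is the union of the images of all faces $\partial_{j,\eta}$, $(j,\eta)\ne(i,\varepsilon)$. A Kan fibration is a cubical map with the right lifting property with respect to all open box inclusions. Nerve. A graph map $f\colon I_\infty^{\otimes n}\to G$ is stable in all directions if there is $M\ge0$ such that for every $i$, the value of $f$ is unchanged when a coordinate $v_i>M$ is replaced by $M$ and when a coordinate $v_i<-M$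 is replaced by $-M$. $\mathrm{N}G$ is the cubical set with $(\mathrm{N}G)_n$ the set of such maps, where $f\partial_{i,\varepsilon}$ is obtained by setting the $i$-th coordinate of $f$ equal to $(2\varepsilon-1)M$ for $M$ as in the stability condition, $f\sigma_i(v_1,\dots,v_{n+1})=f(v_1,\dots,v_{i-1},v_{i+1},\dots,v_{n+1})$, and $f\gamma_{i,0}$, $f\gamma_{i,1}$ send $(v_1,\dots,v_{n+1})$ to $f(v_1,\dots,v_{i-1},\max(v_i,v_{i+1}),v_{i+2},\dots)$ and $f(v_1,\dots,v_{i-1},\min(v_i,v_{i+1}),v_{i+2},\dots)$ respectively; $\mathrm{N}$ acts on graph maps by postcomposition. Fibration structure. In $\mathsf{Graph}_*$, a map is a fibration if the underlying graph map $f$ has $\mathrm{N}f$ a Kan fibration; it is a weak equivalence if the underlying map $f\colon G\to H$ induces a bijection $A_0(G)\to A_0(H)$ and isomorphisms $A_n(G,u)\to A_n(H,f(u))$ for all vertices $u$ of $G$ and all $n\ge1$; an acyclic fibration is a map that is both. The terminal object is the one-vertex graph. *)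

(* Defs.v *)
From HB Require Import structures.
From Stdlib Require Import Relation_Operators Operators_Properties.
From mathcomp Require Import all_boot all_order all_algebra.
From mathcomp Require Import boolp.
From mathcomp Require Import zify.

Set Implicit Arguments.
Unset Strict Implicit.
Unset Printing Implicit Defensive.

Import Order.TTheory GRing.Theory Num.Theory.

Local Open Scope quotient_scope.
Local Open Scope ring_scope.

(* Vertices may be infinitely many; [edge] is the irreflexive edge relation and
   [adj] is equal-or-joined-by-an-edge. *)
Record graph := Graph {
  vertex :> Type;
  edge : vertex -> vertex -> Prop;
  edge_sym : forall x y, edge x y -> edge y x;
  edge_irr : forall x, ~ edge x x }.
Arguments edge {g}.

Definition adj (G : graph) (x y : G) : Prop := x = y \/ edge x y.

Lemma adj_refl (G : graph) (x : G) : adj x x.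
Proof. by left. Qed.

Lemma adj_sym (G : graph) (x y : G) : adj x y -> adj y x.
Proof. by case=> [->|/edge_sym]; [left|right]. Qed.

(* The simple graph in which distinct x, y are joined iff R x y; when R is
   also reflexive, R is the relation [adj] of this graph (lemma
   [adj_of_rel]). *)
Section GraphOfRel.
Variables (T : Type) (R : T -> T -> Prop).
Hypothesis Rsym : forall x y, R x y -> R y x.

Lemma of_rel_sym x y : x <> y /\ R x y -> y <> x /\ R y x.
Proof. by case=> xy /Rsym; split=> // yx; apply: xy. Qed.

Lemma of_rel_irr x : ~ (x <> x /\ R x x).
Proof. by case. Qed.

Definition graph_of_rel := Graph of_rel_sym of_rel_irr.

Lemma adj_of_rel0 (x y : graph_of_rel) : adj x y <-> x = y \/ R x y.
Proof.
split=> [[->|[_ Rxy]]|[->|Rxy]]; [by left|by right|by left|].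
by have [->|/asboolP] := pselect (x = y :> T); [left|right; split=> //; apply/asboolP].
Qed.

Lemma adj_of_rel (Rrefl : forall x, R x x) (x y : graph_of_rel) :
  adj x y <-> R x y.
Proof. by rewrite adj_of_rel0; split=> [[->|]|]; [exact: Rrefl| |right]. Qed.
End GraphOfRel.

Record gmap (G H : graph) := GMap {
  gfun :> G -> H;
  gfunP : forall x y, adj x y -> adj (gfun x) (gfun y) }.

Lemma gmap_ext (G H : graph) (f g : gmap G H) : f =1 g -> f = g.
Proof.
case: f g => [f fP] [g gP] /= /funext fg; subst g.
by congr GMap; exact: Prop_irrelevance.
Qed.

Lemma gconst_subproof (G H : graph) (y : H) (x x' : G) :
  adj x x' -> adj y y.
Proof. by left. Qed.
Definition gconst (G H : graph) (y : H) : gmap G H :=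
  GMap (@gconst_subproof G H y).

Definition gid (G : graph) : gmap G G := @GMap G G id (fun _ _ a => a).

Definition gcomp (G H K : graph) (g : gmap H K) (f : gmap G H) : gmap G K :=
  @GMap G K (g \o f) (fun _ _ a => gfunP g (gfunP f a)).

Section Induced.
Variables (G : graph) (P : G -> Prop).
Let R (x y : {x : G | P x}) := adj (sval x) (sval y).
Lemma induced_sym x y : R x y -> R y x. Proof. exact: adj_sym. Qed.
Definition induced : graph := graph_of_rel induced_sym.
Lemma adj_induced (x y : induced) : adj x y <-> adj (sval x) (sval y).
Proof. by apply: adj_of_rel => z; left. Qed.
End Induced.

Section Interval.
Variable m : nat.
Let e (i j : 'I_m.+1) : Prop := j = i.+1 :> nat \/ i = j.+1 :> nat.
Lemma interval_sym i j : e i j -> e j i. Proof. by case; [right|left]. Qed.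
Lemma interval_irr i : ~ e i i. Proof. by rewrite /e; lia. Qed.
Definition I_ : graph := Graph interval_sym interval_irr.
End Interval.

Section IntervalInf.
Let e (i j : int) : Prop := j = i + 1 \/ i = j + 1.
Lemma interval_inf_sym i j : e i j -> e j i.
Proof. by case; [right|left]. Qed.
Lemma interval_inf_irr i : ~ e i i. Proof. by rewrite /e; lia. Qed.
Definition Iinf : graph := Graph interval_inf_sym interval_inf_irr.
End IntervalInf.

Section Product.
Variables G H : graph.
Let R (x y : G * H) : Prop :=
  (x.1 = y.1 /\ adj x.2 y.2) \/ (x.2 = y.2 /\ adj x.1 y.1).
Lemma gprod_sym x y : R x y -> R y x.
Proof. by case=> -[e /adj_sym]; [left|right]. Qed.
Definition gprod : graph := graph_of_rel gprod_sym.
Lemma adj_gprod (x y : gprod) : adj x y <->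
  (x.1 = y.1 /\ adj x.2 y.2) \/ (x.2 = y.2 /\ adj x.1 y.1).
Proof. by apply: adj_of_rel => z; left; split=> //; left. Qed.
End Product.

(* The n-fold product, with coordinates indexed by 'I_n; lemmas [adj_gpow0]
   and [adj_gpowS] identify it with the iterated binary product. *)
Section Power.
Variables (G : graph) (n : nat).
Let R (x y : 'I_n -> G) : Prop :=
  exists i, adj (x i) (y i) /\ forall j, j != i -> x j = y j.
Lemma gpow_sym x y : R x y -> R y x.
Proof.
by case=> i [/adj_sym ? xy]; exists i; split=> // j /xy.
Qed.
Definition gpow : graph := graph_of_rel gpow_sym.
Lemma adj_gpow (x y : gpow) : adj x y <-> x = y \/
  exists i, adj (x i) (y i) /\ forall j, j != i -> x j = y j.
Proof. exact: adj_of_rel0. Qed.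
End Power.

Lemma adj_gpow0 (G : graph) (x y : gpow G 0) : x = y.
Proof. by apply: funext => -[]. Qed.

Lemma adj_gpowS (G : graph) n (x y : gpow G n.+1) :
  adj x y <->
  @adj (gprod G (gpow G n)) (x ord0, fun i => x (lift ord0 i))
                            (y ord0, fun i => y (lift ord0 i)).
Proof.
rewrite adj_gpow adj_gprod /= adj_gpow; split.
- case=> [->|[i]]; first by left; split=> //; left.
  case: (unliftP ord0 i) => [k ->|->] [xy ne].
    left; split; first by apply: ne; rewrite -val_eqE.
    right; exists k; split=> // j jk; apply: ne.
    by rewrite (inj_eq lift_inj).
  right; split=> //; apply: funext => j; apply: ne.
  by rewrite -val_eqE.
- have ext : x ord0 = y ord0 ->
      (fun i => x (lift ord0 i)) = (fun i => y (lift ord0 i)) -> x = y.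
    move=> e0 eS; apply: funext => i; case: (unliftP ord0 i) => [k ->|-> //].
    exact: (congr1 (@^~ k) eS).
  case=> [[e0 [eS|[i [xy ne]]]]|[eS xy]].
  + by left; apply: ext.
  + right; exists (lift ord0 i); split=> // j.
    case: (unliftP ord0 j) => [k ->|-> //].
    by rewrite (inj_eq lift_inj) => /ne.
  + right; exists ord0; split=> // j.
    case: (unliftP ord0 j) => [k -> _|-> /eqP//].
    exact: (congr1 (@^~ k) eS).
Qed.

Record pgraph := PGraph { pg :> graph; pt : pg }.

Record pmap (G H : pgraph) := PMap {
  pfun :> gmap G H;
  pfunP : pfun (pt G) = pt H }.

Lemma pmap_ext (G H : pgraph) (f g : pmap G H) : f =1 g -> f = g.
Proof.
case: f g => [f fP] [g gP] /= /gmap_ext fg; subst g.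
by congr PMap; exact: Prop_irrelevance.
Qed.

Definition pid (G : pgraph) : pmap G G := @PMap G G (gid G) erefl.

Lemma pcomp_subproof (G H K : pgraph) (g : pmap H K) (f : pmap G H) :
  gcomp g f (pt G) = pt K.
Proof. by rewrite /= !pfunP. Qed.
Definition pcomp (G H K : pgraph) (g : pmap H K) (f : pmap G H) : pmap G K :=
  PMap (pcomp_subproof g f).

Definition pone : pgraph := @PGraph (I_ 0) ord0.

Definition is_terminal (T : pgraph) : Prop :=
  forall G : pgraph, exists! f : pmap G T, True.

Lemma pone_terminal : is_terminal pone.
Proof.
move=> G; have c : gconst G (ord0 : I_ 0) (pt G) = pt pone by [].
exists (@PMap G pone _ c); split=> // f _.
by apply: pmap_ext => x; apply: val_inj => /=; case: (f x) => -[].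
Qed.

(* The square   P --e--> E
                |a       |p
                A --f--> B   is cartesian. *)
Definition is_pullback (P A E B : pgraph)
    (a : pmap P A) (e : pmap P E) (f : pmap A B) (p : pmap E B) : Prop :=
  pcomp f a = pcomp p e /\
  forall (X : pgraph) (x : pmap X A) (y : pmap X E),
    pcomp f x = pcomp p y ->
    exists! u : pmap X P, pcomp a u = x /\ pcomp e u = y.

Record pfunctor := PFunctor {
  fobj :> pgraph -> pgraph;
  fmap : forall G H : pgraph, pmap G H -> pmap (fobj G) (fobj H);
  fmap_id : forall G : pgraph, fmap (pid G) = pid (fobj G);
  fmap_comp : forall (G H K : pgraph) (g : pmap H K) (f : pmap G H),
    fmap (pcomp g f) = pcomp (fmap g) (fmap f) }.

Lemma ord2P (t : 'I_2) : t = ord0 \/ t = ord_max.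
Proof. by case: t => -[|[|//]] i; [left|right]; apply: val_inj. Qed.

Section Hom.
Variables G H : graph.
Let R (f g : gmap G H) : Prop :=
  exists h : gmap (gprod G (I_ 1)) H,
    (forall x, h (x, ord0) = f x) /\ (forall x, h (x, ord_max) = g x).

Let RP f g : R f g <-> forall x, adj (f x) (g x).
Proof.
split=> [[h [h0 h1]] x|fg].
  rewrite -h0 -h1; apply: gfunP; apply/adj_gprod.
  by left; split=> //; right; left.
pose h (x : gprod G (I_ 1)) : H := if x.2 == ord0 then f x.1 else g x.1.
suff hP x y : adj x y -> adj (h x) (h y) by exists (GMap hP).
case: x y => [x s] [y t] /adj_gprod[[/= <- _]|[/= <- xy]]; rewrite /h /=.
  case: eqP => _; case: eqP => _; [by left|exact: fg| |by left].
  exact/adj_sym/fg.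
by case: eqP => _; apply: gfunP.
Qed.

Lemma ghom_sym f g : R f g -> R g f.
Proof. by rewrite !RP => fg x; apply/adj_sym/fg. Qed.
Definition ghom : graph := graph_of_rel ghom_sym.
Lemma adj_ghom (f g : ghom) : adj f g <->
  exists h : gmap (gprod G (I_ 1)) H,
    (forall x, h (x, ord0) = f x) /\ (forall x, h (x, ord_max) = g x).
Proof. by apply: adj_of_rel => k; apply/RP => x; left. Qed.
Lemma adj_ghomP (f g : ghom) :
  adj f g <-> forall x, adj ((f : gmap G H) x) ((g : gmap G H) x).
Proof. by rewrite adj_ghom; exact: RP. Qed.
End Hom.

Definition left_end (G : graph) (p : gmap Iinf G) (x : G) : Prop :=
  exists N : nat, forall i : int, i <= - N%:Z -> p i = x.

Definition right_end (G : graph) (p : gmap Iinf G) (x : G) : Prop :=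
  exists N : nat, forall i : int, N%:Z <= i -> p i = x.

Definition path_graph (G : graph) : graph :=
  @induced (ghom Iinf G)
    (fun p => (exists x, left_end p x) /\ (exists y, right_end p y)).

Definition path_map (G : graph) (p : path_graph G) : gmap Iinf G := sval p.

Definition loop_graph (G : graph) (v : G) : graph :=
  @induced (path_graph G)
    (fun p => left_end (path_map p) v /\ right_end (path_map p) v).

Definition loop_map (G : graph) (v : G) (l : loop_graph v) : gmap Iinf G :=
  path_map (sval l).

Lemma adj_loop (G : graph) (v : G) (l l' : loop_graph v) :
  adj l l' <-> forall i, adj (loop_map l i) (loop_map l' i).
Proof. by rewrite !adj_induced adj_ghomP. Qed.

Lemma loop_ext (G : graph) (v : G) (l l' : loop_graph v) :
  loop_map l =1 loop_map l' -> l = l'.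
Proof.
case: l l' => [[p pP] lP] [[q qP] kP] /gmap_ext pq.
rewrite /loop_map /path_map /= in pq; subst q.
have epq : pP = qP by exact: Prop_irrelevance.
by subst qP; congr exist; exact: Prop_irrelevance.
Qed.

Section MkLoop.
Variables (G : graph) (v : G) (p : gmap Iinf G).
Hypotheses (pl : left_end p v) (pr : right_end p v).
Lemma mk_loop_subproof :
  (exists x, left_end p x) /\ (exists y, right_end p y).
Proof. by split; exists v. Qed.
Definition mk_loop : loop_graph v :=
  exist _ (exist _ p mk_loop_subproof) (conj pl pr).
End MkLoop.

Lemma loop_left (G : graph) (v : G) (l : loop_graph v) :
  left_end (loop_map l) v.
Proof. by case: (svalP l). Qed.
Lemma loop_right (G : graph) (v : G) (l : loop_graph v) :
  right_end (loop_map l) v.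
Proof. by case: (svalP l). Qed.

Lemma const_left (G : graph) (v : G) : left_end (gconst Iinf v) v.
Proof. by exists 0. Qed.
Lemma const_right (G : graph) (v : G) : right_end (gconst Iinf v) v.
Proof. by exists 0. Qed.

Definition loop (G : pgraph) : pgraph :=
  @PGraph (loop_graph (pt G))
    (mk_loop (const_left (pt G)) (const_right (pt G))).

Section LoopFun.
Variables (G H : pgraph) (f : pmap G H).

Lemma post_left (l : loop G) : left_end (gcomp f (loop_map l)) (pt H).
Proof.
by have [N lN] := loop_left l; exists N => i /lN /= ->; rewrite pfunP.
Qed.
Lemma post_right (l : loop G) : right_end (gcomp f (loop_map l)) (pt H).
Proof.
by have [N lN] := loop_right l; exists N => i /lN /= ->; rewrite pfunP.
Qed.

Definition loop_post (l : loop G) : loop H :=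
  mk_loop (post_left l) (post_right l).

Lemma loop_post_adj (l l' : loop G) :
  adj l l' -> adj (loop_post l) (loop_post l').
Proof. by move=> /adj_loop ll; apply/adj_loop => i; exact: gfunP (ll i). Qed.

Lemma loop_post_pt : GMap loop_post_adj (pt (loop G)) = pt (loop H).
Proof. by apply: loop_ext => i /=; exact: pfunP. Qed.

Definition loop_fmap : pmap (loop G) (loop H) := PMap loop_post_pt.
End LoopFun.

Lemma loop_fmap_id (G : pgraph) : loop_fmap (pid G) = pid (loop G).
Proof. by apply: pmap_ext => l; apply: loop_ext. Qed.

Lemma loop_fmap_comp (G H K : pgraph) (g : pmap H K) (f : pmap G H) :
  loop_fmap (pcomp g f) = pcomp (loop_fmap g) (loop_fmap f).
Proof. by apply: pmap_ext => l; apply: loop_ext. Qed.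

Definition loop_functor : pfunctor := PFunctor loop_fmap_id loop_fmap_comp.

(* Coordinates are numbered from 0: i : 'I_n is the (i+1)-st coordinate. *)

Section Coordinates.
Variable T : Type.

Definition upd n (x : 'I_n -> T) (i : 'I_n) (a : T) : 'I_n -> T :=
  fun j => if j == i then a else x j.

Definition insert n (i : 'I_n.+1) (a : T) (x : 'I_n -> T) : 'I_n.+1 -> T :=
  fun j => if unlift i j is Some k then x k else a.

Definition delete n (i : 'I_n.+1) (x : 'I_n.+1 -> T) : 'I_n -> T :=
  fun k => x (lift i k).

(* The coordinates i and i+1 are replaced by the single op x_i x_(i+1). *)
Definition merge n (i : 'I_n) (op : T -> T -> T) (x : 'I_n.+1 -> T) :
    'I_n -> T :=
  fun k => if k == i then op (x (widen_ord (leqnSn n) i)) (x (lift ord0 i))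
           else x (lift (widen_ord (leqnSn n) i) k).

End Coordinates.

Definition cube (n : nat) := 'I_n -> bool.

Definition face n (i : 'I_n.+1) (e : bool) : cube n -> cube n.+1 :=
  insert i e.
Definition degen n (i : 'I_n.+1) : cube n.+1 -> cube n := delete i.
Definition conn n (i : 'I_n.+1) (e : bool) : cube n.+2 -> cube n.+1 :=
  merge i (if e then andb else orb).

Inductive box_gen : forall m n, (cube m -> cube n) -> Prop :=
| box_gen_id n : @box_gen n n id
| box_gen_comp m n p (g : cube n -> cube p) (f : cube m -> cube n) :
    box_gen g -> box_gen f -> box_gen (g \o f)
| box_gen_face n i e : box_gen (@face n i e)
| box_gen_degen n i : box_gen (@degen n i)
| box_gen_conn n i e : box_gen (@conn n i e).

Definition box (m n : nat) := {f : cube m -> cube n | box_gen f}.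

Definition box_id n : box n n := exist _ id (box_gen_id n).
Definition box_comp m n p (g : box n p) (f : box m n) : box m p :=
  exist _ (sval g \o sval f) (box_gen_comp (svalP g) (svalP f)).
Definition box_face n i e : box n n.+1 := exist _ _ (@box_gen_face n i e).
Definition box_degen n i : box n.+1 n := exist _ _ (@box_gen_degen n i).
Definition box_conn n i e : box n.+2 n.+1 := exist _ _ (@box_gen_conn n i e).

Lemma box_ext m n (f g : box m n) : sval f = sval g -> f = g.
Proof.
by case: f g => [f fP] [g gP] /= fg; subst g; congr exist;
  exact: Prop_irrelevance.
Qed.

Record cset := CSet {
  cell :> nat -> Type;
  act : forall m n, box m n -> cell n -> cell m;
  act_id : forall n (x : cell n), act (box_id n) x = x;
  act_comp : forall m n p (g : box n p) (f : box m n) (x : cell p),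
    act (box_comp g f) x = act f (act g x) }.

Record cmap (X Y : cset) := CMap {
  cfun :> forall n, X n -> Y n;
  cfunP : forall m n (f : box m n) (x : X n),
    cfun (act f x) = act f (cfun x) }.

Lemma rep_act_id N n (x : box n N) : box_comp x (box_id n) = x.
Proof. exact: box_ext. Qed.
Lemma rep_act_comp N m n p (g : box n p) (f : box m n) (x : box p N) :
  box_comp x (box_comp g f) = box_comp (box_comp x g) f.
Proof. exact: box_ext. Qed.

Definition rep (N : nat) : cset :=
  @CSet (fun n => box n N) (fun m n f x => box_comp x f)
    (@rep_act_id N) (@rep_act_comp N).

Section OpenBox.
Variables (N : nat) (i : 'I_N.+1) (e : bool).

Definition in_obox n (x : box n N.+1) : Prop :=
  exists j d, (j, d) <> (i, e) /\
    exists y : box n N, x = box_comp (box_face j d) y.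

Definition obox_cell n := {x : box n N.+1 | in_obox x}.

Lemma obox_act_subproof m n (f : box m n) (x : obox_cell n) :
  in_obox (box_comp (sval x) f).
Proof.
case: x => x /= [j [d [ne [y xE]]]]; exists j, d; split=> //.
by exists (box_comp y f); rewrite xE; apply: box_ext.
Qed.
Definition obox_act m n (f : box m n) (x : obox_cell n) : obox_cell m :=
  exist _ _ (obox_act_subproof f x).

Lemma obox_ext n (x y : obox_cell n) : sval x = sval y -> x = y.
Proof.
by case: x y => [x xP] [y yP] /= xy; subst y; congr exist;
  exact: Prop_irrelevance.
Qed.

Lemma obox_act_id n (x : obox_cell n) : obox_act (box_id n) x = x.
Proof. exact/obox_ext/box_ext. Qed.
Lemma obox_act_comp m n p (g : box n p) (f : box m n) (x : obox_cell p) :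
  obox_act (box_comp g f) x = obox_act f (obox_act g x).
Proof. exact/obox_ext/box_ext. Qed.

Definition obox : cset := CSet obox_act_id obox_act_comp.

Definition obox_incl : cmap obox (rep N.+1) :=
  @CMap obox (rep N.+1) (fun n x => sval x) (fun m n f x => erefl).
End OpenBox.

Definition has_rlp (A B X Y : cset) (i : cmap A B) (p : cmap X Y) : Prop :=
  forall (a : cmap A X) (b : cmap B Y),
    (forall n (x : A n), p n (a n x) = b n (i n x)) ->
    exists l : cmap B X,
      (forall n (x : A n), l n (i n x) = a n x) /\
      (forall n (x : B n), p n (l n x) = b n x).

Definition kan_fibration (X Y : cset) (p : cmap X Y) : Prop :=
  forall n (i : 'I_n.+1) (e : bool), has_rlp (obox_incl i e) p.

Definition stable_at (G : graph) n (f : gmap (gpow Iinf n) G) (M : nat) :=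
  forall (i : 'I_n) (v : 'I_n -> int),
    (M%:Z < v i -> f v = f (upd v i M%:Z)) /\
    (v i < - M%:Z -> f v = f (upd v i (- M%:Z))).

Definition stable (G : graph) n (f : gmap (gpow Iinf n) G) : Prop :=
  exists M : nat, stable_at f M.

(* A morphism phi of the box category is built from constants, projections,
   max and min.  [ext M phi] is the function given by the same expressions
   on integers, with arguments clamped to [-M, M] and with 0, 1 read as -M, M:
   for - M <= t < M, one has t < ext M phi v j iff phi sends the boolean
   vector (t < v i)_i to a vector with j-th coordinate 1 (lemma [extP]). *)
Definition thr n (t : int) (v : 'I_n -> int) : cube n := fun i => t < v i.

Definition ext m n (M : nat) (phi : cube m -> cube n) (v : 'I_m -> int) :
    'I_n -> int :=
  fun j => (\sum_(k < M.*2) phi (thr (k%:Z - M%:Z) v) j)%N%:Z - M%:Z.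

Definition clamp n (M : nat) (v : 'I_n -> int) : 'I_n -> int :=
  fun i => Num.max (- M%:Z) (Num.min M%:Z (v i)).

Definition cube_mono m n (phi : cube m -> cube n) : Prop :=
  forall x y : cube m, (forall i, x i -> y i) -> forall j, phi x j -> phi y j.

Lemma box_mono m n (phi : cube m -> cube n) : box_gen phi -> cube_mono phi.
Proof.
elim=> {m n phi} [n|m n p g f _ gm _ fm|n i e|n i|n i e] x y xy j /=.
- exact: xy.
- by apply: gm => k; apply: fm.
- by rewrite /face /insert; case: unlift => // k; apply: xy.
- exact: xy.
- rewrite /conn /merge; case: eqP => _; last exact: xy.
  by case: e => [/andP[/xy -> /xy ->]|/orP[/xy ->|/xy ->]] //; rewrite orbT.
Qed.

Lemma count_thr (b : nat -> bool) N :
  (forall k, b k.+1 -> b k) ->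
  forall k, (k < N)%N -> (k < \sum_(l < N) b l)%N = b k.
Proof.
move=> bS; have bD k l : (k <= l)%N -> b l -> b k.
  by elim: l => [|l IH]; [rewrite leqn0 => /eqP->|
    rewrite leq_eqVlt => /orP[/eqP->//|kl /bS]; apply: IH].
elim: N => // N IH k; rewrite big_ord_recr /=.
have le : (\sum_(l < N) b l <= N)%N.
  by rewrite -[leqRHS]card_ord -sum1_card leq_sum // => l _; case: (b l).
have [bN|bN] := boolP (b N).
  move=> kN; rewrite (bD k N) //.
  suff -> : (\sum_(l < N) b l)%N = N by lia.
  rewrite -[RHS]card_ord -sum1_card; apply: eq_bigr => l _.
  by rewrite (bD l N) // ltnW.
rewrite addn0 ltnS leq_eqVlt => /orP[/eqP ->|/IH //].
by rewrite (negbTE bN) ltnNge le.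
Qed.

Section Ext.
Variables (m n : nat) (M : nat) (phi : cube m -> cube n).

Lemma ext_ge v j : - M%:Z <= ext M phi v j. Proof. by rewrite /ext; lia. Qed.

Lemma ext_le v j : ext M phi v j <= M%:Z.
Proof.
suff : (\sum_(k < M.*2) phi (thr (k%:Z - M%:Z) v) j <= M.*2)%N.
  by rewrite /ext; lia.
by rewrite -[leqRHS]card_ord -sum1_card leq_sum // => l _; case: (phi _ _).
Qed.

Lemma extP v j (t : int) : cube_mono phi -> - M%:Z <= t -> t < M%:Z ->
  (t < ext M phi v j) = phi (thr t v) j.
Proof.
move=> mphi t1 t2; have [k tE] : exists k : nat, t = k%:Z - M%:Z.
  by exists `|(t + M%:Z)%R|%N; lia.
rewrite {}tE in t1 t2 *.
rewrite -(count_thr (b := fun k : nat => phi (thr (k%:Z - M%:Z) v) j)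
  (N := M.*2)); [rewrite /ext; lia| |lia].
by move=> l; apply: mphi => i; rewrite /thr; lia.
Qed.
End Ext.

Lemma int_thr (M : nat) (a b : int) :
  - M%:Z <= a <= M%:Z -> - M%:Z <= b <= M%:Z ->
  (forall t : int, - M%:Z <= t -> t < M%:Z -> (t < a) = (t < b)) -> a = b.
Proof.
by move=> aM bM ab; have := ab (a - 1); have := ab (b - 1); have := ab a;
  have := ab b; lia.
Qed.

Lemma ext_eq m n M (phi : cube m -> cube n) v (w : 'I_n -> int) :
  cube_mono phi -> (forall j, - M%:Z <= w j <= M%:Z) ->
  (forall j (t : int), - M%:Z <= t -> t < M%:Z ->
    phi (thr t v) j = (t < w j)) -> ext M phi v = w.
Proof.
move=> mphi wM H; apply: funext => j; apply: (@int_thr M) => //.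
  by rewrite ext_ge ext_le.
by move=> t t1 t2; rewrite extP // H.
Qed.

Lemma clamp_bd n M (v : 'I_n -> int) j : - M%:Z <= clamp M v j <= M%:Z.
Proof. by rewrite /clamp; lia. Qed.

Lemma clamp_thr n M (v : 'I_n -> int) j (t : int) :
  - M%:Z <= t -> t < M%:Z -> (t < clamp M v j) = (t < v j).
Proof. by rewrite /clamp; lia. Qed.

Lemma ext_id n M (v : 'I_n -> int) : ext M id v = clamp M v.
Proof.
apply: ext_eq => [|j|j t t1 t2]; first exact/box_mono/box_gen_id.
  exact: clamp_bd.
by rewrite clamp_thr.
Qed.

Lemma ext_comp m n p M (g : cube n -> cube p) (f : cube m -> cube n) v :
  cube_mono g -> cube_mono f -> ext M (g \o f) v = ext M g (ext M f v).
Proof.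
move=> mg mf; apply: ext_eq => [x y xy j|j|j t t1 t2].
- by apply: mg => k; apply: mf.
- by rewrite ext_ge ext_le.
- rewrite extP //=; congr (g _ j); apply: funext => i.
  by rewrite /thr extP.
Qed.

Lemma ext_face n M i e (v : 'I_n -> int) :
  ext M (@face n i e) v =
  insert i (if e then M%:Z else - M%:Z) (clamp M v).
Proof.
apply: ext_eq => [|j|j t t1 t2]; first exact/box_mono/box_gen_face.
  by rewrite /insert; case: unlift => [k|]; [apply: clamp_bd|case: e; lia].
rewrite /face /insert; case: unlift => [k|]; first by rewrite clamp_thr.
by case: e; lia.
Qed.

Lemma ext_degen n M i (v : 'I_n.+1 -> int) :
  ext M (@degen n i) v = delete i (clamp M v).
Proof.
apply: ext_eq => [|j|j t t1 t2]; first exact/box_mono/box_gen_degen.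
  exact: clamp_bd.
by rewrite /delete clamp_thr.
Qed.

Lemma ext_conn n M i e (v : 'I_n.+2 -> int) :
  ext M (@conn n i e) v = merge i (if e then Num.min else Num.max) (clamp M v).
Proof.
apply: ext_eq => [|j|j t t1 t2]; first exact/box_mono/box_gen_conn.
  rewrite /merge; case: ifP => _; last exact: clamp_bd.
  have := clamp_bd M v (lift ord0 i).
  have := clamp_bd M v (widen_ord (leqnSn n.+1) i).
  by case: e; lia.
rewrite /conn /merge; case: eqP => _; last by rewrite clamp_thr.
rewrite /thr -(clamp_thr v _ t1 t2) -(clamp_thr v (lift ord0 i) t1 t2).
by case: e; lia.
Qed.

Lemma ext_clamp m n M M' (phi : cube m -> cube n) v :
  cube_mono phi -> (M <= M')%N -> clamp M (ext M' phi v) = ext M phi v.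
Proof.
move=> mphi MM; apply/esym/ext_eq => [//|j|j t t1 t2].
  exact: clamp_bd.
by rewrite clamp_thr // extP //; lia.
Qed.

Lemma adj_Iinf (a b : Iinf) : adj a b <-> `|(a : int) - (b : int)| <= 1.
Proof.
rewrite /adj /=; split; first by case=> [->|[|]]; lia.
move=> ab; have [|] : a = b \/ (b = a + 1 \/ a = b + 1 :> int) by lia.
- by left.
- by right.
Qed.

Lemma clamp_adj n M (v w : gpow Iinf n) :
  adj v w -> @adj (gpow Iinf n) (clamp M v) (clamp M w).
Proof.
move/adj_gpow => [->|[i [/adj_Iinf vw ne]]]; first by left.
apply/adj_gpow; right; exists i; split; last first.
  by move=> j /ne; rewrite /clamp => ->.
by apply/adj_Iinf; rewrite /clamp; lia.
Qed.

Lemma insert_adj n i (a : int) (v w : gpow Iinf n) :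
  adj v w -> @adj (gpow Iinf n.+1) (insert i a v) (insert i a w).
Proof.
move/adj_gpow => [->|[k [vw ne]]]; first by left.
apply/adj_gpow; right; exists (lift i k); rewrite /insert liftK; split=> // j.
by case: unliftP => [l ->|//]; rewrite (inj_eq lift_inj) => /ne.
Qed.

Lemma delete_adj n i (v w : gpow Iinf n.+1) :
  adj v w -> @adj (gpow Iinf n) (delete i v) (delete i w).
Proof.
move/adj_gpow => [->|[k [vw ne]]]; first by left.
apply/adj_gpow; case: (unliftP i k) vw ne => [l ->|->] vw ne; last first.
  by left; apply: funext => j; apply: ne; rewrite eq_sym neq_lift.
right; exists l; split=> // j jl; apply: ne.
by rewrite (inj_eq lift_inj).
Qed.

Lemma merge_adj n i (op : int -> int -> int) (v w : gpow Iinf n.+1) :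
  (forall a b a' b' : int, `|a - a'| <= 1 -> `|b - b'| <= 1 ->
     `|op a b - op a' b'| <= 1) ->
  adj v w -> @adj (gpow Iinf n) (merge i op v) (merge i op w).
Proof.
move=> opP /adj_gpow [->|[k [/adj_Iinf vw ne]]]; first by left.
have ne' j : j != k -> `|(v j : int) - (w j : int)| <= 1.
  by move=> /ne ->; lia.
have all1 j : `|(v j : int) - (w j : int)| <= 1.
  by have [->|/ne'] := eqVneq j k.
apply/adj_gpow; right.
set wi := widen_ord (leqnSn n) i.
have [kw|] := boolP ((k == wi) || (k == lift ord0 i)).
  exists i; split=> [|j ji].
    by apply/adj_Iinf; rewrite /merge eqxx; apply: opP.
  rewrite /merge (negbTE ji) -/wi; apply: ne.
  apply: contraTneq kw => <-; rewrite negb_or eq_sym neq_lift /=.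
  apply: contra_neq ji => /(congr1 val); rewrite /= /bump /= => e.
  by apply: val_inj => /=; lia.
rewrite negb_or => /andP[k1 k2].
case: (unliftP wi k) (k1) => [l kE _|-> /eqP//].
have li : l != i.
  apply: contra_neq k2 => li; rewrite kE li; apply: val_inj => /=.
  by rewrite /bump /= leqnn.
exists l; split=> [|j jl].
  by rewrite /merge (negbTE li) -/wi -kE; apply/adj_Iinf.
rewrite /merge -/wi; case: eqP => _; last first.
  by apply: ne; rewrite kE (inj_eq lift_inj).
by rewrite !ne // eq_sym.
Qed.

Lemma ext_adj m n M (phi : cube m -> cube n) : box_gen phi ->
  forall v w : gpow Iinf m, adj v w ->
  @adj (gpow Iinf n) (ext M phi v) (ext M phi w).
Proof.
elim=> {m n phi} [n|m n p g f gP gm fP fm|n i e|n i|n i e] v w vw.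
- by rewrite !ext_id; apply: clamp_adj.
- have [mg mf] := (box_mono gP, box_mono fP).
  rewrite (ext_comp M v mg mf) (ext_comp M w mg mf).
  exact/gm/fm.
- by rewrite !ext_face; apply/insert_adj/clamp_adj.
- by rewrite !ext_degen; apply/delete_adj/clamp_adj.
- rewrite !ext_conn; apply: merge_adj; last exact: clamp_adj.
  by case: e => a b a' b'; lia.
Qed.

Lemma stable_clamp (G : graph) n (f : gmap (gpow Iinf n) G) M v :
  stable_at f M -> f (clamp M v) = f v.
Proof.
move=> fM.
have H k : (k <= n)%N ->
    f (fun i : 'I_n => if (i < k)%N then clamp M v i else v i) = f v.
  elim: k => [//|k IH] kn; rewrite -IH; last exact: ltnW.
  pose i := Ordinal kn; set w := (X in _ = f X).
  have wi : w i = v i by rewrite /w /= ltnn.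
  have -> : (fun i : 'I_n => if (i < k.+1)%N then clamp M v i else v i) =
            upd w i (clamp M v i).
    apply: funext => j; rewrite /upd /w.
    by have [->|] := eqVneq j i; [rewrite ltnS leqnn|
      rewrite -val_eqE /= => jk; have -> : (j < k.+1)%N = (j < k)%N by lia].
  have [f1 f2] := fM i w; rewrite wi in f1 f2.
  have [lt|] := boolP (M%:Z < v i).
    rewrite f1 //; congr (f (upd _ _ _)); rewrite /clamp; lia.
  have [lt _|c1 c2] := boolP (v i < - M%:Z).
    rewrite f2 //; congr (f (upd _ _ _)); rewrite /clamp; lia.
  congr (f _); apply: funext => j; rewrite /upd; case: eqP => // ->.
  by rewrite wi /clamp; lia.
rewrite -[RHS](H n (leqnn n)); congr (f _); apply: funext => j.
by rewrite ltn_ord.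
Qed.

Lemma stable_leq (G : graph) n (f : gmap (gpow Iinf n) G) M M' :
  stable_at f M -> (M <= M')%N -> stable_at f M'.
Proof.
move=> fM MM i v.
have H (a : int) : (forall j, clamp M (upd v i a) j = clamp M v j) ->
    f v = f (upd v i a).
  move=> e; rewrite -(stable_clamp v fM) -(stable_clamp (upd v i a) fM).
  by congr (f _); apply: funext => j; rewrite e.
by split=> vi; apply: H => j; rewrite /clamp /upd; case: eqP => // ->; lia.
Qed.

Definition ncell (G : graph) (n : nat) :=
  {f : gmap (gpow Iinf n) G | stable f}.

Lemma ncell_ext (G : graph) n (f g : ncell G n) : sval f =1 sval g -> f = g.
Proof.
case: f g => [f fP] [g gP] /= fg.
have {}fg : f = g by exact: gmap_ext.
by subst g; congr exist; exact: Prop_irrelevance.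
Qed.

(* Some stability bound of f; the operators below do not depend on the
   choice (lemma [nerve_actE]). *)
Definition bound (G : graph) n (f : ncell G n) : nat := sval (cid (svalP f)).

Lemma boundP (G : graph) n (f : ncell G n) : stable_at (sval f) (bound f).
Proof. exact: svalP (cid (svalP f)). Qed.

Section NerveAct.
Variables (G : graph) (m n : nat) (phi : box m n) (f : ncell G n).

Definition nerve_act_fun (v : gpow Iinf m) : G :=
  sval f (ext (bound f) (sval phi) v).

Lemma nerve_act_adj v w :
  adj v w -> adj (nerve_act_fun v) (nerve_act_fun w).
Proof. by move=> vw; apply/gfunP/ext_adj => //; apply: svalP phi. Qed.

Lemma nerve_act_stable : stable (GMap nerve_act_adj).
Proof.
exists (bound f) => i v; split=> vi /=; rewrite /nerve_act_fun;
  congr (sval f _); apply: funext => j; rewrite /ext;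
  (congr (_%:Z - _); apply: eq_bigr => k _; congr (nat_of_bool (sval phi _ j)));
  apply: funext => l; rewrite /thr /upd; case: eqP => // ->;
  by have := ltn_ord k; lia.
Qed.

Definition nerve_act : ncell G m := exist _ _ nerve_act_stable.

Lemma nerve_actE M v : stable_at (sval f) M ->
  sval nerve_act v = sval f (ext M (sval phi) v).
Proof.
move=> fM; have mphi := box_mono (svalP phi); rewrite /= /nerve_act_fun.
set B := bound f; have fB := boundP f; pose K := maxn M B.
rewrite -(@ext_clamp _ _ B K) ?leq_maxr //.
rewrite -(@ext_clamp _ _ M K) ?leq_maxl //.
by rewrite !stable_clamp.
Qed.
End NerveAct.

Lemma nerve_act_id (G : graph) n (f : ncell G n) : nerve_act (box_id n) f = f.
Proof.
apply: ncell_ext => v; rewrite (nerve_actE _ _ (boundP f)) /= ext_id.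
by rewrite stable_clamp //; exact: boundP.
Qed.

Lemma nerve_act_comp (G : graph) m n p (g : box n p) (h : box m n)
    (f : ncell G p) :
  nerve_act (box_comp g h) f = nerve_act h (nerve_act g f).
Proof.
apply: ncell_ext => v.
pose K := maxn (bound f) (bound (nerve_act g f)).
have fK : stable_at (sval f) K.
  by apply: stable_leq (boundP f) _; rewrite leq_maxl.
have gK : stable_at (sval (nerve_act g f)) K.
  by apply: stable_leq (boundP _) _; rewrite leq_maxr.
rewrite (nerve_actE _ _ fK) (nerve_actE _ _ gK) (nerve_actE _ _ fK) /=.
by rewrite ext_comp //; apply: box_mono; apply: svalP.
Qed.

Definition nerve (G : graph) : cset :=
  @CSet (ncell G) (@nerve_act G) (@nerve_act_id G) (@nerve_act_comp G).

(* As faces, degeneracies and connections generate the box category,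
   [nerve_face], [nerve_degen] and [nerve_conn] determine the action. *)
Lemma nerve_face (G : graph) n (f : nerve G n.+1) i e M v :
  stable_at (sval f) M ->
  sval (act (box_face i e) f) v =
  sval f (insert i ((2 * (e : nat)%:Z - 1) * M%:Z) v).
Proof.
move=> fM; rewrite /= -/(sval (nerve_act _ _) _).
transitivity (sval f (ext M (@face n i e) v)); first exact: (nerve_actE (box_face i e)).
rewrite ext_face -(stable_clamp _ fM) -[RHS](stable_clamp _ fM).
congr (sval f _); apply: funext => j; rewrite /clamp /insert.
by case: unlift => [k|]; rewrite ?/clamp; [lia|case: e; lia].
Qed.

Lemma nerve_degen (G : graph) n (f : nerve G n) i v :
  sval (act (box_degen i) f) v = sval f (delete i v).
Proof.
have fM := boundP f; rewrite /= /nerve_act_fun /= ext_degen.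
by rewrite -[RHS](stable_clamp _ fM).
Qed.

Lemma nerve_conn (G : graph) n (f : nerve G n.+1) i e v :
  sval (act (box_conn i e) f) v =
  sval f (merge i (if e then Num.min else Num.max) v).
Proof.
have fM := boundP f; rewrite /= /nerve_act_fun /= ext_conn.
rewrite -[RHS](stable_clamp _ fM); congr (sval f _); apply: funext => j.
by rewrite /clamp /merge; case: ifP => _ //; case: e; lia.
Qed.

Section NerveMap.
Variables (G H : graph) (f : gmap G H).

Lemma nerve_post_stable_at n (x : ncell G n) M :
  stable_at (sval x) M -> stable_at (gcomp f (sval x)) M.
Proof.
by move=> xM i v; have [x1 x2] := xM i v; split=> [/x1|/x2] /= ->.
Qed.
Lemma nerve_post_stable n (x : ncell G n) : stable (gcomp f (sval x)).
Proof. by exists (bound x); apply/nerve_post_stable_at/boundP. Qed.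

Definition nerve_post n (x : nerve G n) : nerve H n :=
  exist _ _ (nerve_post_stable x).

Lemma nerve_postP m n (phi : box m n) (x : nerve G n) :
  nerve_post (act phi x) = act phi (nerve_post x).
Proof.
apply: ncell_ext => v; symmetry.
by apply: (nerve_actE phi (f := nerve_post x)); apply/nerve_post_stable_at/boundP.
Qed.

Definition nerve_map : cmap (nerve G) (nerve H) := CMap nerve_postP.
End NerveMap.

Section ClassicalQuotient.
Variables (T : Type) (R : T -> T -> Prop).
Hypotheses (Rrefl : forall x, R x x) (Rsym : forall x y, R x y -> R y x).
Hypothesis Rtrans : forall y x z, R x y -> R y z -> R x z.

Let r : rel {classic T} := fun x y => `[< R x y >].
Lemma cquot_refl : reflexive r. Proof. by move=> x; apply/asboolP. Qed.
Lemma cquot_sym : symmetric r.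
Proof. by move=> x y; apply/asboolP/asboolP; apply: Rsym. Qed.
Lemma cquot_trans : transitive r.
Proof. by move=> y x z /asboolP xy /asboolP yz; apply/asboolP/(Rtrans xy). Qed.
Definition cquot_equiv := EquivRel r cquot_refl cquot_sym cquot_trans.

Definition cquot := {eq_quot cquot_equiv}.
HB.instance Definition _ := Choice.on cquot.

Definition class (x : T) : cquot := \pi_cquot (x : {classic T}).
Definition member (q : cquot) : T := repr q.

Lemma memberK q : class (member q) = q. Proof. exact: reprK. Qed.
Lemma classP x y : class x = class y <-> R x y.
Proof.
have P := @eqquotP {classic T} _ cquot x y.
by split=> [/P/asboolP|/asboolP/P].
Qed.
Lemma member_class x : R (member (class x)) x.
Proof. by apply/classP; rewrite memberK. Qed.
End ClassicalQuotient.

Definition connected (G : graph) : G -> G -> Prop := clos_refl_trans G (@adj G).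

Lemma connected_refl (G : graph) (x : G) : connected x x.
Proof. exact: rt_refl. Qed.
Lemma connected_sym (G : graph) (x y : G) : connected x y -> connected y x.
Proof.
elim=> [a b /adj_sym|a|a b c _ ba _ cb]; [exact: rt_step|exact: rt_refl|].
exact: rt_trans cb ba.
Qed.
Lemma connected_trans (G : graph) (y x z : G) :
  connected x y -> connected y z -> connected x z.
Proof. exact: rt_trans. Qed.

Definition A0 (G : graph) :=
  cquot (@connected_refl G) (@connected_sym G) (@connected_trans G).

Definition A0_class (G : graph) (x : G) : A0 G :=
  class (@connected_refl G) (@connected_sym G) (@connected_trans G) x.

Definition A0_map (G H : graph) (f : gmap G H) (a : A0 G) : A0 H :=
  A0_class (f (member a)).

Lemma A0_mapE (G H : graph) (f : gmap G H) (x : G) :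
  A0_map f (A0_class x) = A0_class (f x).
Proof.
apply/classP; have : connected (member (A0_class x)) x by apply: member_class.
move: (member _) => y.
elim=> [a b /(gfunP f)|a|a b c _ ab _ bc]; first exact: rt_step.
  exact: rt_refl.
exact: rt_trans ab bc.
Qed.

Definition based_at (G : graph) (x : G) n (f : (gpow Iinf n) -> G) (M : nat) :=
  forall v : gpow Iinf n, (exists i, M%:Z <= `|v i : int|) -> f v = x.

Record bmap (n : nat) (G : graph) (x : G) := BMap {
  bfun :> gmap (gpow Iinf n) G;
  bfunP : exists M : nat, based_at x bfun M }.

Lemma bmap_ext n (G : graph) (x : G) (f g : bmap n x) : f =1 g -> f = g.
Proof.
case: f g => [f fP] [g gP] /= fg.
have {}fg : f = g by exact: gmap_ext.
by subst g; congr BMap; exact: Prop_irrelevance.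
Qed.

Definition bhomotopic n (G : graph) (x : G) (f g : bmap n x) : Prop :=
  exists (m : nat) (h : gmap (gprod (gpow Iinf n) (I_ m)) G),
    [/\ forall v, h (v, ord0) = f v,
        forall v, h (v, ord_max) = g v &
        exists K : nat, forall t, based_at x (fun v => h (v, t)) K].

Section Homotopy.
Variables (n : nat) (G : graph) (x : G).
Implicit Types f g h : bmap n x.

(* A based homotopy is a finite sequence of based maps, consecutive ones being
   pointwise adjacent. *)
Definition bstep f g : Prop := forall v, adj (f v) (g v).

Lemma based_leq (f : gpow Iinf n -> G) M K :
  based_at x f M -> (M <= K)%N -> based_at x f K.
Proof.
by move=> fM MK v [i vi]; apply: fM; exists i; apply: le_trans vi; lia.
Qed.

Lemma homotopy_steps f g :
  bhomotopic f g -> clos_refl_trans _ bstep f g.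
Proof.
case=> m [h [h0 h1 [K hK]]].
have sl_adj t v w : adj v w -> adj (h (v, t)) (h (w, t)).
  by move=> vw; apply/gfunP/adj_gprod; right.
pose sl t : bmap n x :=
  @BMap n G x (GMap (sl_adj t)) (ex_intro _ K (hK t)).
have -> : f = sl (@ord0 m) by apply: bmap_ext => v /=; rewrite h0.
have -> : g = sl (@ord_max m) by apply: bmap_ext => v /=; rewrite h1.
have -> : ord_max = @inord m m.
  by apply: val_inj; rewrite /= inordK.
suff H k : (k <= m)%N ->
  clos_refl_trans _ bstep (sl (@ord0 m)) (sl (@inord m k)) by exact: H.
elim: k => [_|k IH km].
  have -> : @inord m 0 = ord0 by apply: val_inj; rewrite /= inordK.
  exact: rt_refl.
apply: rt_trans (IH (ltnW km)) _; apply: rt_step => v /=.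
apply/gfunP/adj_gprod; left; split=> //; right; left.
by rewrite !inordK //; lia.
Qed.

Lemma steps_homotopy f g :
  clos_refl_trans _ bstep f g -> bhomotopic f g.
Proof.
move=> fg; have {fg} : clos_refl_trans_n1 _ bstep f g by apply: clos_rt_rtn1.
elim=> {g} [|g' h gh _ [m [k [k0 k1 [K kK]]]]].
  have aP (u w : gprod (gpow Iinf n) (I_ 0)) : adj u w -> adj (f u.1) (f w.1).
    by move=> /adj_gprod[[-> _]|[_ uw]]; [left|apply: gfunP].
  exists 0, (GMap aP); split=> //.
  by have [M fM] := bfunP f; exists M => t v /fM.
pose F (u : gprod (gpow Iinf n) (I_ m.+1)) : G :=
  if (u.2 <= m)%N then k (u.1, inord u.2) else h u.1.
have kmax v (t : 'I_m.+2) : val t = m -> k (v, inord t) = g' v.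
  move=> /= ->; rewrite -k1; congr (k (_, _)).
  by apply: val_inj; rewrite /= inordK.
have Fe v (s t : 'I_m.+2) : t = s.+1 :> nat -> adj (F (v, s)) (F (v, t)).
  move=> ts; rewrite /F /=; have := ltn_ord t; rewrite ts => tm.
  rewrite (_ : (s <= m)%N) //; case: ifP => sm.
    apply/gfunP/adj_gprod; left; split=> //; right; left.
    by rewrite !inordK //; lia.
  by rewrite kmax; [exact: gh|rewrite /=; lia].
have FP u w : adj u w -> adj (F u) (F w).
  case: u w => [u s] [w t] /adj_gprod /= [[<- [->|[ts|st]]]|[<- uw]].
  - by left.
  - exact: Fe.
  - exact/adj_sym/Fe.
  - rewrite /F /=; case: ifP => _; last exact: gfunP.
    by apply/gfunP/adj_gprod; right.
have [M hM] := bfunP h.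
exists m.+1, (GMap FP); split=> [v|v|].
- rewrite /= /F /= -k0; congr (k (_, _)).
  by apply: val_inj; rewrite /= inordK.
- by rewrite /= /F /= ltnn.
- exists (maxn K M) => t v /= vK; rewrite /F /=; case: ifP => _.
    exact: (based_leq (kK (@inord m t)) (leq_maxl K M) vK).
  exact: (based_leq hM (leq_maxr K M) vK).
Qed.

Lemma homotopyP f g : bhomotopic f g <-> clos_refl_trans _ bstep f g.
Proof. by split=> [/homotopy_steps|/steps_homotopy]. Qed.

Lemma bhomotopic_step f g : bstep f g -> bhomotopic f g.
Proof. by move=> fg; apply/homotopyP/rt_step. Qed.
Lemma bhomotopic_refl f : bhomotopic f f.
Proof. exact/homotopyP/rt_refl. Qed.
Lemma bhomotopic_sym f g : bhomotopic f g -> bhomotopic g f.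
Proof.
rewrite !homotopyP; elim=> [a b ab|a|a b c _ ba _ cb].
- by apply: rt_step => v; apply/adj_sym/ab.
- exact: rt_refl.
- exact: rt_trans cb ba.
Qed.
Lemma bhomotopic_trans g f h :
  bhomotopic f g -> bhomotopic g h -> bhomotopic f h.
Proof. by rewrite !homotopyP; exact: rt_trans. Qed.

Definition A := cquot bhomotopic_refl bhomotopic_sym bhomotopic_trans.
HB.instance Definition _ := Choice.on A.

Definition A_class f : A :=
  class bhomotopic_refl bhomotopic_sym bhomotopic_trans f.

Lemma A_classP f g : A_class f = A_class g <-> bhomotopic f g.
Proof. exact: classP. Qed.

Lemma A_ind (P : A -> Prop) : (forall f, P (A_class f)) -> forall a, P a.
Proof. by move=> Pf a; rewrite -[a]memberK; apply: Pf. Qed.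
End Homotopy.

Section BMapPost.
Variables (n : nat) (G H : graph) (f : gmap G H) (x : G).
Lemma bpost_subproof (p : bmap n x) :
  exists M : nat, based_at (f x) (gcomp f p) M.
Proof. by have [M pM] := bfunP p; exists M => v /pM /= ->. Qed.
Definition bpost (p : bmap n x) : bmap n (f x) := BMap (bpost_subproof p).

Definition A_map (a : A n x) : A n (f x) := A_class (bpost (member a)).

Lemma A_mapE (p : bmap n x) : A_map (A_class p) = A_class (bpost p).
Proof.
apply/classP/homotopyP.
have /homotopyP : bhomotopic (member (A_class p)) p by apply: member_class.
move: (member _) => q0; elim=> [a b ab|a|a b c _ ab _ bc]; last exact: rt_trans ab bc.
  by apply: rt_step => v; exact: gfunP (ab v).
exact: rt_refl.
Qed.
End BMapPost.

(* Based maps are concatenated along the first coordinate. *)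

Section Concat.
Variables (n : nat) (G : graph) (x : G).
Implicit Types f g h : bmap n.+1 x.

Local Notation shift v a := (upd v ord0 a).

Lemma upd0_adj (p : int -> int) (v w : gpow Iinf n.+1) :
  (forall a b : int, `|a - b| <= 1 -> `|p a - p b| <= 1) -> adj v w ->
  @adj (gpow Iinf n.+1) (shift v (p (v ord0))) (shift w (p (w ord0))).
Proof.
move=> pP /adj_gpow[->|[i [vw ne]]]; first by left.
apply/adj_gpow; right; exists i; split=> [|j /ne e].
  rewrite /upd; case: eqP vw => // -> /adj_Iinf vw.
  by apply/adj_Iinf/pP.
by rewrite /upd; case: eqP e => // -> ->.
Qed.

Lemma adj_fst (v w : gpow Iinf n.+1) :
  adj v w -> `|(v ord0 : int) - (w ord0 : int)| <= 1.
Proof.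
move/adj_gpow=> [->|[i [vw ne]]]; first by lia.
have [i0|/ne ->] := eqVneq ord0 i; last by lia.
by rewrite -i0 in vw; apply/adj_Iinf.
Qed.

Definition cat_ok (a c : int) f g : Prop :=
  (forall v : gpow Iinf n.+1, a <= v ord0 -> f v = x) /\
  (forall v : gpow Iinf n.+1, v ord0 <= a - c -> g v = x).

Definition cat_fun (a c : int) f g (v : gpow Iinf n.+1) : G :=
  if (v ord0 : int) <= a then f v else g (shift v (v ord0 - c)).

Section Cat.
Variables (a c : int) (f g : bmap n.+1 x).
Hypothesis ok : cat_ok a c f g.

Lemma cat_adj v w : adj v w -> adj (cat_fun a c f g v) (cat_fun a c f g w).
Proof.
have right_fun (u : gpow Iinf n.+1) : a <= u ord0 ->
    cat_fun a c f g u = g (shift u (u ord0 - c)).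
  rewrite /cat_fun; case: ifP => // u1 u2.
  rewrite (ok.1 _ u2) ok.2 // /upd eqxx; lia.
move=> vw; have d := adj_fst vw.
have [va|va] := boolP ((v ord0 : int) <= a); last first.
  rewrite !right_fun; try lia.
  by apply/gfunP/(upd0_adj (p := fun t => t - c)) => // s t; lia.
have [wa|wa] := boolP ((w ord0 : int) <= a).
  by rewrite /cat_fun va wa; apply: gfunP.
rewrite !right_fun; try lia.
by apply/gfunP/(upd0_adj (p := fun t => t - c)) => // s t; lia.
Qed.

Lemma cat_based : exists M : nat, based_at x (GMap cat_adj) M.
Proof.
have [M fM] := bfunP f; have [N gN] := bfunP g.
exists (M + N + `|c|)%N => v [i vi] /=; rewrite /cat_fun; case: ifP => _.
  by apply: fM; exists i; lia.
apply: gN; exists i; rewrite /upd; case: eqP vi => [->|_]; lia.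
Qed.

Definition cat : bmap n.+1 x := BMap cat_based.
End Cat.

Definition bbound f : nat := sval (cid (bfunP f)).
Lemma bboundP f : based_at x f (bbound f).
Proof. exact: svalP (cid (bfunP f)). Qed.

Lemma based_ok f g (M N : nat) : based_at x f M -> based_at x g N ->
  cat_ok M (M + N)%N f g.
Proof.
by move=> fM gN; split=> v v0; [apply: fM|apply: gN]; exists ord0; lia.
Qed.

(* With M, N such that f and g are constant where some coordinate has absolute
   value at least M, resp. N, the concatenation is f(v) for v_0 <= M and
   g(v_0 - (M + N), v_1, ...) for v_0 > M. *)
Definition concat f g : bmap n.+1 x :=
  cat (based_ok (@bboundP f) (@bboundP g)).

Definition A_mul (p q : A n.+1 x) : A n.+1 x :=
  A_class (concat (member p) (member q)).

Lemma bconst_subproof :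
  exists M : nat, based_at x (gconst (gpow Iinf n.+1) x) M.
Proof. by exists 0. Qed.
Definition bconst : bmap n.+1 x := BMap bconst_subproof.

Definition A_one : A n.+1 x := A_class bconst.

Lemma brev_adj f (v w : gpow Iinf n.+1) : adj v w ->
  adj (f (shift v (- v ord0))) (f (shift w (- w ord0))).
Proof.
by move=> vw; apply/gfunP/(upd0_adj (p := fun t => - t)) => // s t; lia.
Qed.
Lemma brev_subproof f : exists M : nat, based_at x (GMap (brev_adj f)) M.
Proof.
have [M fM] := bfunP f; exists M => v [i vi]; apply: fM; exists i.
by rewrite /upd; case: eqP vi => [->|]; lia.
Qed.
Definition brev f : bmap n.+1 x := BMap (brev_subproof f).

Definition A_inv (p : A n.+1 x) : A n.+1 x := A_class (brev (member p)).

Lemma cat_indep a c a' c' f g (ok : cat_ok a c f g) (ok' : cat_ok a' c' f g) :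
  bhomotopic (cat ok) (cat ok').
Proof.
have same_c b b' d (okb : cat_ok b d f g) (okb' : cat_ok b' d f g) :
    cat okb = cat okb'.
  apply: bmap_ext => v /=; rewrite /cat_fun.
  case: ifP => vb; case: ifP => vb' //.
    by rewrite (okb'.1 v) ?okb.2 // /upd ?eqxx; lia.
  by rewrite (okb.1 v) ?okb'.2 // /upd ?eqxx; lia.
have incr_c b d (k : nat) (okb : cat_ok b d f g)
    (okb' : cat_ok b (d + k%:Z) f g) : bhomotopic (cat okb) (cat okb').
  elim: k okb' => [|k IH] okb'.
    suff -> : cat okb = cat okb' by exact: bhomotopic_refl.
    by apply: bmap_ext => v /=; rewrite /cat_fun addr0.
  have okk : cat_ok b (d + k%:Z) f g.
    by split=> v v0; [exact: okb.1|apply: okb.2; lia].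
  apply: bhomotopic_trans (IH okk) _; apply: bhomotopic_step => v /=.
  rewrite /cat_fun; case: ifP => _; first by left.
  apply/gfunP/adj_gpow; right; exists ord0; split=> [|j]; last first.
    by rewrite /upd => /negbTE ->.
  by apply/adj_Iinf; rewrite /upd eqxx; lia.
pose k := `|c'|%N + `|c|%N + `|a|%N + `|a'|%N.
pose C := c + k%:Z; pose k' := `|(C - c')%R|%N.
have ok1 : cat_ok a C f g.
  by split=> v v0; [exact: ok.1|apply: ok.2; rewrite /C in v0; lia].
have ok2 : cat_ok a' (c' + k'%:Z) f g.
  by split=> v v0; [exact: ok'.1|apply: ok'.2; lia].
apply: bhomotopic_trans (incr_c _ _ _ ok ok1) _.
apply: bhomotopic_trans (bhomotopic_sym (incr_c _ _ _ ok' ok2)).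
have CE : c' + k'%:Z = C by rewrite /k' /C /k; lia.
move: ok2; rewrite CE => ok2.
rewrite (same_c _ _ _ ok1 ok2); exact: bhomotopic_refl.
Qed.

Lemma cat_step a c f g f' g' (ok : cat_ok a c f g) (ok' : cat_ok a c f' g') :
  bstep f f' -> bstep g g' -> bhomotopic (cat ok) (cat ok').
Proof.
move=> ff gg; apply: bhomotopic_step => v /=.
by rewrite /cat_fun; case: ifP => _; [exact: ff|exact: gg].
Qed.

Lemma based_common f g h : exists M : nat,
  [/\ based_at x f M, based_at x g M & based_at x h M].
Proof.
have [M fM] := bfunP f; have [N gN] := bfunP g; have [P hP] := bfunP h.
by exists (M + N + P)%N; split; apply: based_leq; eauto; lia.
Qed.

Lemma concat_homotopic f f' g g' :
  bhomotopic f f' -> bhomotopic g g' -> bhomotopic (concat f g) (concat f' g').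
Proof.
move=> /homotopyP ff /homotopyP gg.
apply: (@bhomotopic_trans _ _ _ (concat f' g)).
  elim: ff => {f f'} [f f' ff|f|f1 f2 f3 _ h12 _ h23].
  - have [M [fM f'M gM]] := based_common f f' g.
    have ok := based_ok fM gM; have ok' := based_ok f'M gM.
    apply: bhomotopic_trans (cat_indep _ ok) _.
    apply: bhomotopic_trans (cat_indep ok' _).
    by apply: cat_step => // v; left.
  - exact: bhomotopic_refl.
  - exact: bhomotopic_trans h12 h23.
elim: gg => {g g'} [g g' gg|g|g1 g2 g3 _ h12 _ h23].
- have [M [gM g'M f'M]] := based_common g g' f'.
  have ok := based_ok f'M gM; have ok' := based_ok f'M g'M.
  apply: bhomotopic_trans (cat_indep _ ok) _.
  apply: bhomotopic_trans (cat_indep ok' _).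
  by apply: cat_step => // v; left.
- exact: bhomotopic_refl.
- exact: bhomotopic_trans h12 h23.
Qed.

Lemma A_mulE f g : A_mul (A_class f) (A_class g) = A_class (concat f g).
Proof. by apply/A_classP/concat_homotopic; apply: member_class. Qed.

Lemma A_mul_cat a c f g (ok : cat_ok a c f g) :
  A_mul (A_class f) (A_class g) = A_class (cat ok).
Proof. by rewrite A_mulE; apply/A_classP/cat_indep. Qed.

Lemma A_invE f : A_inv (A_class f) = A_class (brev f).
Proof.
apply/A_classP/homotopyP.
have /homotopyP : bhomotopic (member (A_class f)) f by apply: member_class.
move: (member _) => q0; elim=> [p q pq|p|p q r _ pq _ qr]; last exact: rt_trans pq qr.
  by apply: rt_step => v; exact: pq.
exact: rt_refl.
Qed.

Lemma A_mulA : associative A_mul.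
Proof.
elim/A_ind=> f; elim/A_ind=> g; elim/A_ind=> h.
have [M [fM gM hM]] := based_common f g h.
have okgh := based_ok gM hM; have okfg := based_ok fM gM.
have okl : cat_ok M (M + M)%N f (cat okgh).
  split=> v v0; first exact: (based_ok fM gM).1.
  by rewrite /= /cat_fun ifT; [apply: gM; exists ord0|]; lia.
have okr : cat_ok (3 * M)%N (4 * M)%N (cat okfg) h.
  split=> v v0; last by apply: hM; exists ord0; lia.
  rewrite /= /cat_fun; case: ifP => v1.
    by apply: fM; exists ord0; lia.
  by apply: gM; exists ord0; rewrite /upd eqxx; lia.
rewrite (A_mul_cat okgh) (A_mul_cat okfg) (A_mul_cat okl) (A_mul_cat okr).
congr A_class; apply: bmap_ext => v /=; rewrite /cat_fun /= /cat_fun.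
have upd0 (b : int) : shift v b ord0 = b by rewrite /upd eqxx.
rewrite !upd0; case: ifP => v1.
  by rewrite ifT //; lia.
case: ifP => v2; first by rewrite ifT //; lia.
rewrite ifF; last by lia.
congr (h _); apply: funext => j; rewrite /upd; case: eqP => // _; lia.
Qed.

Lemma A_mul1 : left_id A_one A_mul.
Proof.
elim/A_ind=> f; have [M fM] := bfunP f.
have ok : cat_ok (- M%:Z) 0 bconst f.
  by split=> v v0 //; apply: fM; exists ord0; lia.
rewrite /A_one (A_mul_cat ok); congr A_class; apply: bmap_ext => v /=.
rewrite /cat_fun; case: ifP => v0.
  by rewrite /= fM //; exists ord0; lia.
by congr (f _); apply: funext => j; rewrite /upd; case: eqP => // ->; lia.
Qed.

Lemma A_mulr1 : right_id A_one A_mul.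
Proof.
elim/A_ind=> f; have [M fM] := bfunP f.
have ok : cat_ok M 0 f bconst.
  by split=> v v0 //; apply: fM; exists ord0; lia.
rewrite /A_one (A_mul_cat ok); congr A_class; apply: bmap_ext => v /=.
rewrite /cat_fun; case: ifP => v0 //=.
by rewrite fM //; exists ord0; lia.
Qed.

Lemma A_mulrV : right_inverse A_one A_inv A_mul.
Proof.
elim/A_ind=> f; rewrite A_invE; have [M fM] := bfunP f.
have rM : based_at x (brev f) M.
  move=> v [i vi]; apply: fM; exists i.
  by rewrite /upd; case: eqP vi => [->|]; lia.
rewrite (A_mul_cat (based_ok fM rM)); apply/A_classP/bhomotopic_sym.
pose tent (t : nat) (s : int) : int :=
  Num.min s (Num.min (t%:Z - M%:Z) (2 * M%:Z - s)).
have tent_adj t (v w : gpow Iinf n.+1) : adj v w ->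
    adj (f (shift v (tent t (v ord0)))) (f (shift w (tent t (w ord0)))).
  move=> vw; apply/gfunP/(upd0_adj (p := tent t)) => // a b.
  by rewrite /tent; lia.
have tent_based t : exists N : nat, based_at x (GMap (tent_adj t)) N.
  exists (3 * M)%N => v [i vi]; apply: fM; exists i.
  by rewrite /upd; case: eqP vi => [->|]; rewrite /tent; lia.
pose T t : bmap n.+1 x := BMap (tent_based t).
have -> : bconst = T 0.
  apply: bmap_ext => v /=; rewrite fM //; exists ord0.
  by rewrite /upd eqxx /tent; lia.
have -> : cat (based_ok fM rM) = T (2 * M)%N.
  apply: bmap_ext => v /=; rewrite /cat_fun; case: ifP => v0 /=;
    congr (f _); apply: funext => j; rewrite /upd; case: eqP => // e;
    by rewrite ?e ?eqxx /tent; lia.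
elim: (2 * M)%N => [|t IH]; first exact: bhomotopic_refl.
apply: bhomotopic_trans IH _; apply: bhomotopic_step => v /=.
apply/gfunP/adj_gpow; right; exists ord0; split=> [|j].
  by apply/adj_Iinf; rewrite /upd eqxx /tent; lia.
by rewrite /upd => /negbTE ->.
Qed.

Lemma A_mulVr : left_inverse A_one A_inv A_mul.
Proof.
elim/A_ind=> f; rewrite A_invE.
have {2}-> : f = brev (brev f).
  apply: bmap_ext => v /=; congr (f _); apply: funext => j.
  by rewrite /upd !eqxx; case: eqP => // ->; rewrite opprK.
by rewrite -(A_invE (brev f)) A_mulrV.
Qed.

HB.instance Definition _ := isGroup.Build (A n.+1 x)
  A_mulA A_mul1 A_mulr1 A_mulVr A_mulrV.
End Concat.

Definition group_iso (S T : groupType) (f : S -> T) : Prop :=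
  {morph f : a b / (a * b)%g} /\ bijective f.

Definition fibration (G H : pgraph) (f : pmap G H) : Prop :=
  kan_fibration (nerve_map f).

Definition weak_equivalence (G H : pgraph) (f : pmap G H) : Prop :=
  bijective (A0_map f) /\
  forall (n : nat) (u : G), group_iso (@A_map n.+1 G H f u).

Definition acyclic_fibration (G H : pgraph) (f : pmap G H) : Prop :=
  fibration f /\ weak_equivalence f.

Definition exact_functor (F : pfunctor) : Prop :=
  [/\ forall (G H : pgraph) (f : pmap G H),
        fibration f -> fibration (fmap F f),
      forall (G H : pgraph) (f : pmap G H),
        acyclic_fibration f -> acyclic_fibration (fmap F f),
      forall (P X E B : pgraph) (a : pmap P X) (e : pmap P E)
             (f : pmap X B) (p : pmap E B),
        fibration p -> is_pullback a e f p ->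
        is_pullback (fmap F a) (fmap F e) (fmap F f) (fmap F p) &
      forall T : pgraph, is_terminal T -> is_terminal (F T)].

(* Main.v *)
From Stdlib Require Import Relation_Operators Operators_Properties.
From mathcomp Require Import all_boot all_order all_algebra.
From mathcomp Require Import boolp zify.
Require Import Defs.

Set Implicit Arguments.
Unset Strict Implicit.
Unset Printing Implicit Defensive.

Import Order.TTheory GRing.Theory Num.Theory.

Local Open Scope ring_scope.

(** The loop functor is exact because a grid of loops in [G] is a grid in [G]
    of one dimension more. A map from the n-dimensional integer grid to the
    loop graph whose loops have a common bound is the same thing as a map from
    the (n+1)-dimensional grid to [G] that takes the basepoint as value far
    out in the additional coordinate, here [ord0]. Adjacency matches too:
    loops are adjacent when they are so pointwise, and one step along a loop
    is a step in the additional coordinate. Each part of exactness is read off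
    through this currying.

    Fibrations. An n-cube in the nerve of the loop graph is an (n+1)-cube in
    the nerve of [G] whose two faces in direction [ord0] are constant. So an
    open box of loops, completed by these constant faces, is an open box of
    [G] of one dimension more ([obox_extension]). A lift of the filler along
    [f] has constant faces in direction [ord0], hence is a cube of loops
    ([loop_fibration]).

    Weak equivalences. Currying turns [A_n] of the loop graph at a loop [l]
    into homotopy classes of (n+1)-dimensional grids in [G] that coincide far
    out with the reference map [v |-> l (v ord0)]. For [l] constant this is
    [A_(n+1)] of [G], but all basepoints [l] have to be treated. The reference
    map is deformed instead of the group: it is contracted to a constant
    through the truncations [v |-> l (min (v ord0) m)]. A deformation step
    which is close in the sense of [close] does not affect whether [f] is
    bijective on relative homotopy classes, since a grid can be cut off at a
    box and continued outside it by the new reference map ([rel_bij_close],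
    [rel_bij_contract]). Components of the loop graph are the case n = 0.

    Pullbacks. The universal property, tested on the graph of compatible
    pairs, says that the vertices of a pullback are these pairs and that
    adjacency is componentwise; so a loop in a pullback is a pair of loops
    with the same image ([loop_pullback]). *)

(** * Maps of the integer grid relative to a reference map *)

Section Relative.
Variables (n : nat) (G : graph).
Implicit Types R h k : gmap (gpow Iinf n) G.

Definition agree_off R h (M : nat) : Prop :=
  forall v : gpow Iinf n, (exists i, M%:Z <= `|v i : int|) -> h v = R v.

Definition rel_to R h : Prop := exists M, agree_off R h M.

Definition rel_step R h k : Prop :=
  [/\ rel_to R h, rel_to R k & forall v, adj (h v) (k v)].

Definition rel_htpy R := clos_refl_trans _ (rel_step R).

Lemma rel_htpy_sym R h k : rel_htpy R h k -> rel_htpy R k h.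
Proof.
elim=> [a b [aR bR ab]|a|a b c _ ba _ cb]; last exact: rt_trans cb ba.
- by apply: rt_step; split=> // v; apply/adj_sym.
- exact: rt_refl.
Qed.

Lemma rel_htpy_trans R k h l :
  rel_htpy R h k -> rel_htpy R k l -> rel_htpy R h l.
Proof. exact: rt_trans. Qed.

Lemma agree_leq R h M K : agree_off R h M -> (M <= K)%N -> agree_off R h K.
Proof.
by move=> hM MK v [i vi]; apply: hM; exists i; apply: le_trans vi; lia.
Qed.

End Relative.

(** A map is to be replaced by [R'] outside a box on whose border it equals [R].
    For this to be a graph map, [R] at a border point must be adjacent to [R']
    at every neighbouring point, which is stronger than adjacency in the graph
    of maps. *)
Definition close (G H : graph) (R R' : gmap G H) : Prop :=
  forall v w, adj v w -> adj (R v) (R' w).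

Lemma close_sym (G H : graph) (R R' : gmap G H) : close R R' -> close R' R.
Proof. by move=> c v w /adj_sym /c /adj_sym. Qed.

Lemma close_comp (G H K : graph) (f : gmap H K) (R R' : gmap G H) :
  close R R' -> close (gcomp f R) (gcomp f R').
Proof. by move=> c v w /c /(gfunP f). Qed.

Definition in_box n (M : nat) (v : gpow Iinf n) : bool :=
  [forall i, `|v i : int| <= M%:Z].

Lemma in_boxPn n M (v : gpow Iinf n) :
  ~~ in_box M v -> exists i, M%:Z < `|v i : int|.
Proof. by case/forallPn=> i vi; exists i; rewrite ltNge. Qed.

Lemma adj_coord n (v w : gpow Iinf n) i :
  adj v w -> `|(v i : int) - (w i : int)| <= 1.
Proof.
move/adj_gpow=> [->|[j [vw ne]]]; first by lia.
by have [->|/ne ->] := eqVneq i j; [apply/adj_Iinf|lia].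
Qed.

Section Rebase.
Variables (n : nat) (G : graph).
Implicit Types R h k : gmap (gpow Iinf n) G.

Section Def.
Variables (R R' h : gmap (gpow Iinf n) G) (M : nat).
Hypotheses (RR : close R R') (hM : agree_off R h M).

Definition rebase_fun v := if in_box M v then h v else R' v.

Lemma rebase_adj v w : adj v w -> adj (rebase_fun v) (rebase_fun w).
Proof.
have half (u u' : gpow Iinf n) :
    adj u u' -> ~~ in_box M u' -> adj (h u) (R' u').
  move=> uu /in_boxPn[i ui]; rewrite hM; first exact: RR.
  by exists i; have := adj_coord i uu; lia.
move=> vw; rewrite /rebase_fun.
case: ifPn => vM; case: ifPn => wM; try exact: gfunP; first exact: half.
by apply/adj_sym/half => //; apply/adj_sym.
Qed.

Definition rebase := GMap rebase_adj.

Lemma rebase_agree : agree_off R' rebase M.+1.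
Proof.
move=> v [i vi] /=; rewrite /rebase_fun ifN //; apply/forallPn.
by exists i; rewrite -ltNge; lia.
Qed.

Lemma rebase_rel : rel_to R' rebase.
Proof. by exists M.+1; apply: rebase_agree. Qed.
End Def.

(** Rebasing one map with different boxes gives adjacent maps, because at a
    point where these differ one of them is [R] and the other is [R']. *)
Lemma rebase_htpy R R' (c : close R R') h k M N
    (hM : agree_off R h M) (kN : agree_off R k N) :
  rel_htpy R h k -> rel_htpy R' (rebase c hM) (rebase c kN).
Proof.
have box h0 M0 M1 (h0M : agree_off R h0 M0) (h0M' : agree_off R h0 M1) :
    rel_htpy R' (rebase c h0M) (rebase c h0M').
  apply: rt_step; split; [exact: rebase_rel|exact: rebase_rel|move=> v /=].
  have out M2 : agree_off R h0 M2 -> ~~ in_box M2 v -> adj (h0 v) (R' v).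
    move=> h0M2 /in_boxPn[i vi]; rewrite h0M2; first by apply: (c); left.
    by exists i; apply: ltW.
  rewrite /rebase_fun; case: ifPn => v0; case: ifPn => v1; try by left.
    exact: out v1.
  by apply/adj_sym/(out M0).
(* The intermediate maps of a homotopy have bounds of their own. *)
move=> hk; elim: hk M N hM kN =>
  [a b [aR bR ab]|a|a b d ab IHab bd IHbd] M N hM kN.
- apply: (rt_trans _ _ _ (rebase c (agree_leq hM (leq_maxl M N)))).
    exact: box.
  apply: (rt_trans _ _ _ (rebase c (agree_leq kN (leq_maxr M N)))); last first.
    exact: box.
  apply: rt_step; split; [exact: rebase_rel|exact: rebase_rel|move=> v /=].
  by rewrite /rebase_fun; case: ifP => _; [exact: ab|left].
- exact: box.
- suff [K bK] : rel_to R b by apply: rt_trans (IHab _ K _ bK) (IHbd K _ bK _).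
  elim: ab {IHab IHbd bd kN} (ex_intro _ M hM : rel_to R a) => // [x y []//|].
  by move=> x y z _ xy _ yz /xy.
Qed.

(** Cutting off at two boxes in turn changes the map only at points where it is
    [R] and becomes [R'], or the reverse. *)
Lemma rebase_back R R' (c : close R R') (c' : close R' R) h M N
    (hM : agree_off R h M) (kN : agree_off R' (rebase c hM) N) :
  rel_htpy R (rebase c' kN) h.
Proof.
apply: rt_step; split; [exact: rebase_rel|by exists M|move=> v /=].
have RR' : adj (R v) (R' v) by apply: (c); left.
have hout : ~~ in_box M v -> h v = R v.
  by case/in_boxPn=> i vi; apply: (hM); exists i; apply: ltW.
have kv : ~~ in_box N v -> rebase_fun R' h M v = R' v.
  by case/in_boxPn=> i vi; apply: (kN v); exists i; apply: ltW.
rewrite /rebase_fun; case: ifPn => [_ /=|/kv].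
  rewrite /rebase_fun; case: ifPn => [_|/hout ->]; first by left.
  exact: adj_sym.
by rewrite /rebase_fun; case: ifPn => [_ ->|/hout -> _] //; left.
Qed.
End Rebase.

(** For constant [R] this is bijectivity of [f] on [A_n], but [R] need not be
    constant; it is stated on representatives, as there is no group
    for other [R]. *)
Definition rel_bij n (G H : graph) (f : gmap G H) (R : gmap (gpow Iinf n) G) :=
  (forall g, rel_to (gcomp f R) g ->
     exists2 h, rel_to R h & rel_htpy (gcomp f R) (gcomp f h) g) /\
  (forall h k, rel_to R h -> rel_to R k ->
     rel_htpy (gcomp f R) (gcomp f h) (gcomp f k) -> rel_htpy R h k).

Lemma agree_comp n (G H : graph) (f : gmap G H) (R h : gmap (gpow Iinf n) G) M :
  agree_off R h M -> agree_off (gcomp f R) (gcomp f h) M.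
Proof. by move=> hM v /hM /= ->. Qed.

(** Rebasing commutes with composition with [f] and, by [rebase_htpy] and
    [rebase_back], induces mutually inverse bijections on relative homotopy
    classes in the source and in the target. *)
Lemma rel_bij_close n (G H : graph) (f : gmap G H)
    (R R' : gmap (gpow Iinf n) G) :
  close R R' -> rel_bij f R -> rel_bij f R'.
Proof.
move=> c [surj inj]; have c' := close_sym c.
have d := close_comp f c; have d' := close_comp f c'.
have compE (S S' h : gmap (gpow Iinf n) G) M
    (e : close S S') (e' : close (gcomp f S) (gcomp f S'))
    (hM : agree_off S h M) :
    gcomp f (rebase e hM) = rebase e' (agree_comp f hM).
  by apply: gmap_ext => v /=; rewrite /rebase_fun; case: ifP.
split=> [g [M gM]|h k [M hM] [N kN] hk].
- have [h [N hN] hg] := surj _ (rebase_rel d' gM).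
  exists (rebase c hN); first exact: rebase_rel.
  rewrite (compE _ _ _ _ c d).
  apply: rel_htpy_trans (rebase_back d (rebase_agree d' gM)).
  exact (rebase_htpy d (agree_comp f hN) (rebase_agree d' gM) hg).
- have hk' : rel_htpy R (rebase c' hM) (rebase c' kN).
    apply: inj; [exact: rebase_rel|exact: rebase_rel|].
    by rewrite !(compE _ _ _ _ c' d'); apply: rebase_htpy.
  apply: rel_htpy_trans (rel_htpy_sym (rebase_back c (rebase_agree c' hM))) _.
  apply: rel_htpy_trans (rebase_back c (rebase_agree c' kN)).
  exact: rebase_htpy.
Qed.

(** * Currying: grids in the loop graph are grids of one dimension more *)

Lemma insert_delete T n (i : 'I_n.+1) (v : 'I_n.+1 -> T) :
  insert i (v i) (delete i v) = v.
Proof.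
by apply: funext => j; rewrite /insert /delete; case: unliftP => [k|] ->.
Qed.

Lemma insertK T n (i : 'I_n.+1) a (v : 'I_n -> T) : delete i (insert i a v) = v.
Proof. by apply: funext => k; rewrite /delete /insert liftK. Qed.

Lemma insert_at T n (i : 'I_n.+1) a (v : 'I_n -> T) : insert i a v i = a.
Proof. by rewrite /insert unlift_none. Qed.

Section Curry.
Variables (n : nat) (G : graph) (x : G).
Implicit Types g : gmap (gpow Iinf n) (loop_graph x).

Section Uncurry.
Variable g : gmap (gpow Iinf n) (loop_graph x).

Definition uncurry_fun (v : gpow Iinf n.+1) : G :=
  loop_map (g (delete ord0 v)) (v ord0).

Lemma uncurry_adj v w : adj v w -> adj (uncurry_fun v) (uncurry_fun w).
Proof.
move/adj_gpowS/adj_gprod=> /= [[e vw]|[e vw]]; rewrite /uncurry_fun.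
  by rewrite e; apply/(adj_loop _ _).1/gfunP.
by rewrite {1}/delete e; apply: gfunP.
Qed.

Definition uncurry := GMap uncurry_adj.
End Uncurry.

Section CurryDef.
Variables (h : gmap (gpow Iinf n.+1) G) (K : nat).
Hypothesis hK : forall v, K%:Z <= `|v ord0 : int| -> h v = x.

Lemma slice_adj (v : gpow Iinf n) (a b : Iinf) :
  adj a b -> adj (h (insert ord0 a v)) (h (insert ord0 b v)).
Proof.
move=> ab; apply/gfunP/adj_gpow; right; exists ord0; rewrite !insert_at.
by split=> // j; rewrite /insert; case: unliftP => [k ->|-> /eqP].
Qed.

Lemma slice_left v : left_end (GMap (slice_adj v)) x.
Proof. by exists K => i iK /=; rewrite hK // insert_at; lia. Qed.

Lemma slice_right v : right_end (GMap (slice_adj v)) x.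
Proof. by exists K => i iK /=; rewrite hK // insert_at; lia. Qed.

Definition slice v : loop_graph x := mk_loop (slice_left v) (slice_right v).

Lemma curry_adj v w : adj v w -> adj (slice v) (slice w).
Proof. by move=> vw; apply/adj_loop => i /=; apply/gfunP/insert_adj. Qed.

Definition curry := GMap curry_adj.

Lemma curryK : uncurry curry = h.
Proof. by apply: gmap_ext => v; rewrite /= /uncurry_fun /= insert_delete. Qed.
End CurryDef.

Lemma uncurry_insert g i v : uncurry g (insert ord0 i v) = loop_map (g v) i.
Proof. by rewrite /= /uncurry_fun insertK insert_at. Qed.

Lemma uncurry_inj : injective uncurry.
Proof.
move=> g g' gg; apply: gmap_ext => v; apply: loop_ext => i.
by rewrite -!uncurry_insert gg.
Qed.

(** Loops in the image of a box have a common bound, because a box is finite. *)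
Lemma uniform_bound g M : (forall v, g (clamp M v) = g v) ->
  exists K : nat, forall v i, K%:Z <= `|i : int| -> loop_map (g v) i = x.
Proof.
move=> gM.
pose pos (F : {ffun 'I_n -> 'I_(M + M).+1}) : gpow Iinf n :=
  fun i => (F i : nat)%:Z - M%:Z.
have /choice[B BP] F : exists K : nat,
    forall i, K%:Z <= `|i : int| -> loop_map (g (pos F)) i = x.
  have [K1 l1] := loop_left (g (pos F)); have [K2 l2] := loop_right (g (pos F)).
  exists (K1 + K2)%N => i iK.
  by have [i0|i0] := boolP (0 <= (i : int)); [apply: l2|apply: l1]; lia.
exists (\max_F B F)%N => v i iK.
pose F : {ffun 'I_n -> 'I_(M + M).+1} :=
  [ffun k => inord `|(clamp M v k + M%:Z)%R|%N].
have cE : clamp M v = pos F.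
  apply: funext => k; rewrite /pos ffunE; have := clamp_bd M v k => vk.
  by rewrite inordK; lia.
rewrite -gM cE; apply: BP; apply: le_trans iK.
by rewrite lez_nat; apply: (leq_bigmax (F := B)).
Qed.

(** The bound on [v ord0] comes from [uniform_bound], which applies because a
    map that is constant off a box takes only values that it takes on the
    box. *)
Lemma uncurry_rel (l : loop_graph x) g : rel_to (gconst _ l) g <->
  rel_to (uncurry (gconst (gpow Iinf n) l)) (uncurry g).
Proof.
split=> [[M gM]|[M gM]]; last first.
  exists M => v [i vi]; apply: loop_ext => a.
  rewrite -uncurry_insert gM; first by rewrite uncurry_insert.
  by exists (lift ord0 i); rewrite /insert liftK.
have gc v : g (clamp M v) = g v.
  have [vM|/in_boxPn[i vi]] := boolP (in_box M v).
    congr (g _); apply: funext => i; have /forallP/(_ i) := vM.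
    by rewrite /clamp; lia.
  by rewrite !gM //; exists i; rewrite /clamp; lia.
have [K gK] := uniform_bound gc.
have [K1 l1] := loop_left l; have [K2 l2] := loop_right l.
exists (M + K + K1 + K2)%N => v [i].
case: (unliftP ord0 i) => [j ->|->] vi; rewrite /= /uncurry_fun.
  by rewrite gM //; exists j; rewrite /delete; lia.
rewrite gK /=; last by lia.
have [v0|v0] := boolP (0 <= (v ord0 : int)); first by rewrite l2 //; lia.
by rewrite l1 //; lia.
Qed.

Lemma rel_uncurry (l : loop_graph x) (h : gmap (gpow Iinf n.+1) G) :
  rel_to (uncurry (gconst (gpow Iinf n) l)) h ->
  exists2 g, uncurry g = h & rel_to (gconst _ l) g.
Proof.
case=> M hM; have [K1 l1] := loop_left l; have [K2 l2] := loop_right l.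
have hK v : (M + K1 + K2)%N%:Z <= `|v ord0 : int| -> h v = x.
  move=> vK; rewrite hM; last by exists ord0; lia.
  rewrite /= /uncurry_fun /=.
  by have [v0|v0] := boolP (0 <= (v ord0 : int));
    [rewrite l2 //|rewrite l1 //]; lia.
by exists (curry hK); rewrite ?uncurry_rel curryK //; exists M.
Qed.

(** For the converse, each map occurring in a relative homotopy of maps to [G]
    is the uncurrying of a map to the loop graph ([rel_uncurry]). *)
Lemma uncurry_htpy (l : loop_graph x) g g' : rel_to (gconst _ l) g ->
  rel_htpy (gconst _ l) g g' <->
  rel_htpy (uncurry (gconst (gpow Iinf n) l)) (uncurry g) (uncurry g').
Proof.
move=> gl; split.
  elim=> [a b [al bl ab]|a|a b c _ ab _ bc]; last exact: rt_trans ab bc.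
  - apply: rt_step; split; [exact/uncurry_rel|exact/uncurry_rel|move=> v].
    exact: (adj_loop _ _).1 (ab _) _.
  - exact: rt_refl.
move=> hh; have {hh} := clos_rt_rt1n _ _ _ _ hh.
move hE : (uncurry g) => h; move hE' : (uncurry g') => h' hh.
elim: hh g hE gl hE' => [a|a b c [_ bR ab] _ IH] g ga gl gc.
  by rewrite (uncurry_inj (etrans ga (esym gc))); apply: rt_refl.
have [g1 g1b g1l] := rel_uncurry bR.
apply: rt_trans (IH g1 g1b g1l gc); apply: rt_step; split=> // v.
by apply/adj_loop => i; rewrite -!uncurry_insert ga g1b.
Qed.
End Curry.

Lemma uncurry_post n (G H : pgraph) (f : pmap G H)
    (g : gmap (gpow Iinf n) (loop G)) :
  gcomp f (uncurry g) = uncurry (gcomp (loop_fmap f) g).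
Proof. exact: gmap_ext. Qed.

Lemma gcomp_const (G H K : graph) (f : gmap H K) (y : H) :
  gcomp f (gconst G y) = gconst G (f y).
Proof. exact: gmap_ext. Qed.

Lemma rel_bij_uncurry n (G H : pgraph) (f : pmap G H) (l : loop G) :
  rel_bij f (uncurry (gconst (gpow Iinf n) l)) ->
  rel_bij (loop_fmap f) (gconst (gpow Iinf n) l).
Proof.
rewrite /rel_bij uncurry_post !gcomp_const => -[surj inj].
split=> [g gR|h k hR kR hk].
  have [h /rel_uncurry[k <- kR] hg] := surj _ ((uncurry_rel _ _).1 gR).
  exists k => //; move: hg; rewrite uncurry_post => /uncurry_htpy; apply.
  by rewrite -gcomp_const; have [M kM] := kR; exists M; apply: agree_comp.
apply/uncurry_htpy => //; apply: inj; try exact/uncurry_rel.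
rewrite !uncurry_post; apply/uncurry_htpy => //.
by rewrite -gcomp_const; have [M hM] := hR; exists M; apply: agree_comp.
Qed.

(** * Weak equivalences and the loop functor *)

(** Truncating a loop at [m] contracts it onto its basepoint as [m] decreases,
    and consecutive truncations are close. *)
Section Truncate.
Variables (n : nat) (G : graph) (x : G) (l : loop_graph x).

Definition truncate_fun (m : int) (v : gpow Iinf n.+1) : G :=
  loop_map l (Num.min (v ord0 : int) m).

Lemma truncate_close m m' v w : `|m - m'| <= 1 -> adj v w ->
  adj (truncate_fun m v) (truncate_fun m' w).
Proof.
by move=> mm vw; apply/gfunP/adj_Iinf; have := adj_coord ord0 vw; lia.
Qed.

Lemma truncate_adj m v w : adj v w -> adj (truncate_fun m v) (truncate_fun m w).
Proof. by apply: truncate_close; lia. Qed.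

Definition truncate m := GMap (@truncate_adj m).

Lemma rel_bij_truncate (H : graph) (f : gmap G H) m (k : nat) :
  rel_bij f (truncate m) -> rel_bij f (truncate (m + k%:Z)).
Proof.
move=> fm; elim: k => [|k]; first by rewrite addr0.
by apply: rel_bij_close => v w; apply: truncate_close; lia.
Qed.

(** Far to the left the truncation is the constant map, far to the right it is
    the loop itself. *)
Lemma rel_bij_contract (H : graph) (f : gmap G H) :
  rel_bij f (gconst (gpow Iinf n.+1) x) ->
  rel_bij f (uncurry (gconst (gpow Iinf n) l)).
Proof.
have [M lM] := loop_left l; have [N lN] := loop_right l.
have <- : truncate (- M%:Z) = gconst _ x.
  by apply: gmap_ext => v; rewrite /= /truncate_fun lM //; lia.
move=> /(@rel_bij_truncate _ _ _ (M + N)%N); congr rel_bij.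
apply: gmap_ext => v; rewrite /= /truncate_fun /uncurry_fun /=.
have [v0|v0] := boolP ((v ord0 : int) <= N%:Z).
  by congr (loop_map l _); lia.
by rewrite !lN //; lia.
Qed.
End Truncate.

Section BasedMaps.
Variables (n : nat) (G : graph) (x : G).

Lemma bmap_rel (p : bmap n x) : rel_to (gconst _ x) p.
Proof. exact: bfunP. Qed.

Lemma rel_htpyP (p q : bmap n x) :
  rel_htpy (gconst _ x) p q <-> bhomotopic p q.
Proof.
rewrite homotopyP; split; last first.
  elim=> [a b ab|a|a b c _ ab _ bc]; last exact: rt_trans ab bc.
  - by apply: rt_step; split=> //; apply: bmap_rel.
  - exact: rt_refl.
move=> pq; have {pq} := clos_rt_rt1n _ _ _ _ pq.
move pE : (bfun p) => h; move qE : (bfun q) => k hk.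
elim: hk p pE qE => [a|a b c [_ [M bM] ab] _ IH] p pa qa.
  suff -> : p = q by apply: rt_refl.
  by apply: bmap_ext => v; rewrite pa qa.
have bB : exists M, based_at x b M by exists M.
apply: rt_trans (IH (BMap bB) erefl qa).
by apply: rt_step => v; rewrite pa; apply: ab.
Qed.

Lemma rel_bmap (h : gmap (gpow Iinf n) G) :
  rel_to (gconst _ x) h -> exists p : bmap n x, bfun p = h.
Proof. by move=> hx; exists (@BMap n G x h hx). Qed.
End BasedMaps.

Lemma inj_surj_bijective (S T : Type) (f : S -> T) :
  injective f -> (forall y, exists x, f x = y) -> bijective f.
Proof.
move=> inj /choice[g gK]; exists g => // x; exact/inj/gK.
Qed.

Lemma A_map_bijP n (G H : graph) (f : gmap G H) (x : G) :
  bijective (@A_map n G H f x) <-> rel_bij f (gconst (gpow Iinf n) x).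
Proof.
rewrite /rel_bij gcomp_const; split.
- case=> F FK KF.
  split=> [g /rel_bmap[q <-]|h k /rel_bmap[p <-] /rel_bmap[q <-]].
    have [p pE] : exists p, F (A_class q) = A_class p.
      by elim/A_ind: (F _) => p; exists p.
    exists p; first exact: bmap_rel.
    apply/(rel_htpyP (bpost f p) q)/A_classP.
    by rewrite -A_mapE -pE KF.
  move=> /(rel_htpyP (bpost f p) (bpost f q))/A_classP pq.
  by apply/rel_htpyP/A_classP/(can_inj FK); rewrite !A_mapE.
- case=> surj inj; apply: inj_surj_bijective.
    elim/A_ind=> p; elim/A_ind=> q; rewrite !A_mapE => /A_classP pq.
    apply/A_classP/rel_htpyP; apply: inj; try exact: bmap_rel.
    exact/(rel_htpyP (bpost f p) (bpost f q)).
  elim/A_ind=> q; have [h /rel_bmap[p <-] pq] := surj q (bmap_rel q).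
  exists (A_class p); rewrite A_mapE; apply/A_classP.
  exact/(rel_htpyP (bpost f p) q).
Qed.

Lemma rel_htpy0 (G : graph) (R : gmap (gpow Iinf 0) G) (x y : G) :
  rel_htpy R (gconst _ x) (gconst _ y) <-> connected x y.
Proof.
have any h : rel_to R h by exists 0 => v [[]].
split; last first.
  elim=> [a b ab|a|a b c _ ab _ bc]; last exact: rt_trans ab bc.
  - by apply: rt_step; split.
  - exact: rt_refl.
pose o : gpow Iinf 0 := fun=> 0.
rewrite -[x in connected x _]/(gconst (gpow Iinf 0) x o).
rewrite -[y in connected _ y]/(gconst (gpow Iinf 0) y o).
elim=> [a b [_ _ ab]|a|a b c _ ab _ bc]; last exact: rt_trans ab bc.
- by apply: rt_step.
- exact: rt_refl.
Qed.

Lemma gmap0 (G : graph) (h : gmap (gpow Iinf 0) G) :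
  h = gconst _ (h (fun=> 0 : int)).
Proof. by apply: gmap_ext => v /=; congr (h _); apply: adj_gpow0. Qed.

(** On the one-point grid every map is relative to every [R], and relative
    homotopy is connectedness. *)
Lemma A0_map_bij (G H : graph) (f : gmap G H) (R : gmap (gpow Iinf 0) G) :
  rel_bij f R -> bijective (A0_map f).
Proof.
have any (K : graph) (S h : gmap (gpow Iinf 0) K) : rel_to S h.
  by exists 0 => v [[]].
have A0_ind (K : graph) (P : A0 K -> Prop) :
    (forall y, P (A0_class y)) -> forall a, P a.
  by move=> Py a; rewrite -[a]memberK; apply: Py.
case=> surj inj; apply: inj_surj_bijective.
  elim/A0_ind=> x; elim/A0_ind=> y; rewrite !A0_mapE => /classP xy.
  apply/classP/(rel_htpy0 R)/inj => //.
  by rewrite !gcomp_const; apply/rel_htpy0.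
elim/A0_ind=> y; have [h _] := surj (gconst _ y) (any _ _ _).
rewrite (gmap0 h) gcomp_const => /rel_htpy0 hy.
by eexists (A0_class _); rewrite A0_mapE; apply/classP/hy.
Qed.

(** A common bound for both factors lets [f] be applied to one explicit
    concatenation; the bounds chosen by [concat] are not preserved by [f]. *)
Lemma A_map_morph n (G H : graph) (f : gmap G H) (x : G) :
  {morph @A_map n.+1 G H f x : a b / (a * b)%g}.
Proof.
elim/A_ind=> p; elim/A_ind=> q.
have [M [pM qM _]] := based_common p q q.
have post (r : bmap n.+1 x) : based_at x r M -> based_at (f x) (bpost f r) M.
  by move=> rM v /rM /= ->.
have ok := based_ok pM qM; have ok' := based_ok (post _ pM) (post _ qM).
rewrite -[LHS]/(A_map f (A_mul (A_class p) (A_class q))).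
rewrite -[RHS]/(A_mul (A_map f (A_class p)) (A_map f (A_class q))).
rewrite (A_mul_cat ok) !A_mapE (A_mul_cat ok'); congr A_class.
by apply: bmap_ext => v /=; rewrite /cat_fun; case: ifP.
Qed.

Lemma loop_weak_equivalence (G H : pgraph) (f : pmap G H) :
  weak_equivalence f -> weak_equivalence (loop_fmap f).
Proof.
case=> _ fA.
have bij n (l : loop G) : rel_bij (loop_fmap f) (gconst (gpow Iinf n) l).
  by apply/rel_bij_uncurry/rel_bij_contract/A_map_bijP; case: (fA n (pt G)).
split; first exact: A0_map_bij (bij 0 (pt _)).
by move=> n u; split; [exact: A_map_morph|apply/A_map_bijP].
Qed.

(** * Nerves of loop graphs and open boxes of one dimension more *)

Lemma delete_insert_lift T n (j : 'I_n.+1) a (w : 'I_n.+1 -> T) :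
  delete ord0 (insert (lift ord0 j) a w) = insert j a (delete ord0 w).
Proof.
apply: funext => k; rewrite /delete.
case: (unliftP j k) => [l|] ->; last by rewrite !insert_at.
have -> : lift ord0 (lift j l) = lift (lift ord0 j) (lift ord0 l).
  by apply: val_inj; rewrite /= /bump /=; lia.
by rewrite /insert !liftK.
Qed.

Lemma delete_upd T n (j : 'I_n) a (v : 'I_n.+1 -> T) :
  delete ord0 (upd v (lift ord0 j) a) = upd (delete ord0 v) j a.
Proof. by apply: funext => k; rewrite /delete /upd (inj_eq lift_inj). Qed.

Lemma insert_upd T n (j : 'I_n) a b (v : 'I_n -> T) :
  insert ord0 b (upd v j a) = upd (insert ord0 b v) (lift ord0 j) a.
Proof.
apply: funext => k; rewrite /insert /upd.
by case: unliftP => [l ->|->] //; rewrite (inj_eq lift_inj).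
Qed.

Definition lower m n (phi : box m n.+1) : box m n :=
  box_comp (box_degen ord0) phi.

Lemma lower_comp l m n (phi : box m n.+1) (psi : box l m) :
  lower (box_comp phi psi) = box_comp (lower phi) psi.
Proof. exact: box_ext. Qed.

Lemma lower_face n (j : 'I_n.+1) d :
  lower (box_face (lift ord0 j) d) = box_comp (box_face j d) (box_degen ord0).
Proof. by apply: box_ext; apply: funext => u; apply: delete_insert_lift. Qed.

Lemma face_inj m n (j : 'I_n.+1) d (y z : box m n) :
  box_comp (box_face j d) y = box_comp (box_face j d) z -> y = z.
Proof.
move=> yz; apply: box_ext; apply: funext => u.
have /(congr1 (fun h => delete j (h u))) := congr1 sval yz.
by rewrite /= /face !insertK.
Qed.

(** The projection determines all coordinates but [ord0]. This lets the value of
    an open box of loops on a projected cell be computed from its value on a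
    face. *)
Lemma lower_factor m n (phi : box m n.+2) (j : 'I_n.+1) d (y : box m n) :
  lower phi = box_comp (box_face j d) y ->
  exists z : box m n.+1, [/\ phi = box_comp (box_face (lift ord0 j) d) z,
    lower z = y & forall u, sval z u ord0 = sval phi u ord0].
Proof.
move=> phiE; exists (box_comp (box_degen (lift ord0 j)) phi).
have phij u : sval phi u (lift ord0 j) = d.
  have /(congr1 (fun h => h u j)) := congr1 sval phiE.
  by rewrite /= /face insert_at.
have fE : phi = box_comp (box_face (lift ord0 j) d)
                  (box_comp (box_degen (lift ord0 j)) phi).
  apply: box_ext; apply: funext => u /=.
  by rewrite /face /degen -(phij u) insert_delete.
split=> // [|u]; last first.
  by rewrite /= /degen /delete; congr (sval phi u _); apply: val_inj.
apply: (@face_inj _ _ j d).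
by rewrite -phiE [in RHS]fE [in RHS]lower_comp lower_face; apply: box_ext.
Qed.

Lemma ext_const m n K (phi : cube m -> cube n) v j d :
  (forall u, phi u j = d) -> ext K phi v j = (if d then K%:Z else - K%:Z).
Proof.
move=> phid; rewrite /ext.
have -> : (\sum_(k < K.*2) phi (thr (k%:Z - K%:Z) v) j = K.*2 * d)%N.
  by under eq_bigr do rewrite phid; rewrite sum_nat_const card_ord.
by case: d {phid}; lia.
Qed.

Lemma const_cell_subproof (G : graph) n (x : G) :
  stable (gconst (gpow Iinf n) x).
Proof. by exists 0. Qed.
Definition const_cell (G : graph) n (x : G) : nerve G n :=
  exist _ _ (@const_cell_subproof G n x).

Section UncurryCell.
Variables (G : graph) (x : G).

Definition bounded n (z : nerve (loop_graph x) n) (K : nat) : Prop :=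
  stable_at (sval z) K /\
  forall v i, K%:Z <= `|i : int| -> loop_map (sval z v) i = x.

Lemma bounded_leq n (z : nerve (loop_graph x) n) K L :
  bounded z K -> (K <= L)%N -> bounded z L.
Proof.
case=> zK lK KL; split; first exact: stable_leq zK KL.
by move=> v i iL; apply: lK; lia.
Qed.

Lemma bounded_ex n (z : nerve (loop_graph x) n) : exists K, bounded z K.
Proof.
have zM := boundP z.
have [K zK] := uniform_bound (fun v => stable_clamp v zM).
exists (maxn (bound z) K); split; first exact: stable_leq zM (leq_maxl _ _).
by move=> v i iL; apply: zK; lia.
Qed.

Lemma uncurry_stable_at n (z : nerve (loop_graph x) n) K :
  bounded z K -> stable_at (uncurry (sval z)) K.
Proof.
case=> zK lK i v; case: (unliftP ord0 i) => [j ->|->].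
  have [z1 z2] := zK j (delete ord0 v).
  have e a : (upd v (lift ord0 j) a) ord0 = v ord0 by [].
  by split=> vi; rewrite /= /uncurry_fun e delete_upd;
    [rewrite -z1|rewrite -z2].
by split=> vi; rewrite /= /uncurry_fun !lK ///upd ?eqxx; lia.
Qed.

Lemma uncurry_stable n (z : nerve (loop_graph x) n) : stable (uncurry (sval z)).
Proof. by have [K /uncurry_stable_at zK] := bounded_ex z; exists K. Qed.

Definition uncurry_cell n (z : nerve (loop_graph x) n) : nerve G n.+1 :=
  exist _ _ (uncurry_stable z).

Lemma uncurry_cell_inj n : injective (@uncurry_cell n).
Proof.
move=> y z /(congr1 sval) /= /uncurry_inj yz.
by apply: ncell_ext => v; rewrite yz.
Qed.

(** This separates the effect of an operator on the grid coordinates from its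
    effect on the loop coordinate. *)
Lemma act_uncurry_cell m n (z : nerve (loop_graph x) n) (phi : box m n.+1) K v :
  bounded z K ->
  sval (act phi (uncurry_cell z)) v =
  loop_map (sval (act (lower phi) z) v) (ext K (sval phi) v ord0).
Proof.
move=> zK; have mphi := box_mono (svalP phi).
rewrite [LHS](nerve_actE phi (f := uncurry_cell z) v (uncurry_stable_at zK)).
rewrite [in RHS](nerve_actE (lower phi) (f := z) v zK.1) /= /uncurry_fun.
rewrite ext_comp //; last exact/box_mono/box_gen_degen.
by rewrite ext_degen ext_clamp.
Qed.

(** A stable map equals its value at the clamped point; where the coordinate
    [ord0] is large, that point lies in one of the two constant faces. *)
Lemma curry_cell n (w : nerve G n.+1) :
  (forall d, act (box_face ord0 d) w = const_cell n x) ->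
  exists z : nerve (loop_graph x) n, uncurry_cell z = w.
Proof.
move=> wx; have wM := boundP w; set M := bound w in wM.
have wE v : M%:Z <= `|v ord0 : int| -> sval w v = x.
  move=> vM; rewrite -(stable_clamp v wM) -(insert_delete ord0 (clamp M v)).
  have := congr1 (fun c : nerve G n => sval c (delete ord0 (clamp M v)))
                 (wx (0 <= (v ord0 : int))).
  rewrite (nerve_face _ _ _ wM) /= => <-; congr (sval w (insert _ _ _)).
  by rewrite /clamp; lia.
have cS : stable (curry wE).
  exists M => i v.
  by split=> vi; apply: loop_ext => b; rewrite /= insert_upd;
    have [w1 w2] := wM (lift ord0 i) (insert ord0 b v);
    rewrite /insert liftK in w1 w2; auto.
exists (exist _ _ cS); apply: ncell_ext => v.
by rewrite /= -[in RHS](curryK wE).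
Qed.
End UncurryCell.

Lemma act_const_cell (G : graph) (x : G) m n (phi : box m n) :
  act phi (const_cell n x : nerve G n) = const_cell m x.
Proof. exact: ncell_ext. Qed.

(** Every face of the larger open box in a direction other than [ord0] projects
    into the smaller one. *)
Lemma lower_notin N (i : 'I_N.+1) e n (phi : box n N.+2) :
  in_obox (lift ord0 i) e phi -> ~ in_obox i e (lower phi) ->
  exists d, forall u, sval phi u ord0 = d.
Proof.
case=> j [d [ne [y phiE]]] np; case: (unliftP ord0 j) => [k jk|j0].
  case: np; exists k, d; split.
    by move=> [ki di]; apply: ne; rewrite jk ki di.
  by exists (lower y); rewrite phiE jk lower_comp lower_face; apply: box_ext.
by exists d => u; rewrite phiE j0 /= /face insert_at.
Qed.

Section ExtendOpenBox.
Variables (G : graph) (x : G) (N : nat) (i : 'I_N.+1) (e : bool).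
Variable a : cmap (obox i e) (nerve (loop_graph x)).

(** The cell prescribed by the open box of loops [a] on [phi]: evaluate the
    loops over the projection of [phi] at the coordinate [ord0] of [phi], and
    take the basepoint where the projection leaves the open box. As the formula
    does not mention a face through which [phi] factors, cells prescribed on
    different faces agree without any check of face identities. *)
Definition extends n (phi : box n N.+2) (c : nerve G n) : Prop :=
  (forall p : in_obox i e (lower phi), exists K0, forall K, (K0 <= K)%N ->
     forall v, sval c v =
       loop_map (sval (a n (exist _ _ p : obox i e n)) v)
         (ext K (sval phi) v ord0))
  /\ (~ in_obox i e (lower phi) -> c = const_cell n x).

(** The prescribed map is a graph map because, through any face containing
    [phi], it is the restriction of an uncurried cube. *)
Lemma extends_ex n (phi : box n N.+2) : exists c, extends phi c.
Proof.
have [p|np] := pselect (in_obox i e (lower phi)); last first.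
  by exists (const_cell n x); split.
have [j [d [ne [y yE]]]] := p.
have [z [phiE zE z0]] := lower_factor yE.
have fP : in_obox i e (box_face j d).
  by exists j, d; split=> //; exists (box_id N); apply: box_ext.
pose w := a N (exist _ _ fP : obox i e N).
have [K0 wK0] := bounded_ex w.
exists (act z (uncurry_cell w)); split=> // q; exists K0 => K KK v.
rewrite (act_uncurry_cell z v (bounded_leq wK0 KK)) zE -cfunP.
have -> : ext K (sval z) v ord0 = ext K (sval phi) v ord0.
  by rewrite /ext; under eq_bigr do rewrite z0.
by congr (loop_map (sval (a _ _) v) _); apply: obox_ext.
Qed.

Lemma extends_uniq n (phi : box n N.+2) c c' :
  extends phi c -> extends phi c' -> c = c'.
Proof.
case=> [cp cn] [cp' cn'].
have [p|np] := pselect (in_obox i e (lower phi)); last by rewrite cn ?cn'.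
have [K cK] := cp p; have [L cL] := cp' p; apply: ncell_ext => v.
by rewrite (cK (maxn K L)) ?leq_maxl // (cL (maxn K L)) ?leq_maxr.
Qed.

(** The coordinate [ord0] of [phi] is then an extremal one, where loops take the
    value [x]; so both clauses of [extends] give the constant cell. *)
Lemma extends_const n (phi : box n N.+2) c d :
  (forall u, sval phi u ord0 = d) -> extends phi c -> c = const_cell n x.
Proof.
move=> phid [cp cn].
have [p|/cn //] := pselect (in_obox i e (lower phi)).
have [K0 cK] := cp p.
have [L [_ aL]] := bounded_ex (a n (exist _ _ p : obox i e n)).
apply: ncell_ext => v; rewrite (cK (maxn K0 L)) ?leq_maxl //.
by rewrite aL // (ext_const _ _ phid); case: d {phid}; lia.
Qed.

Lemma extends_act m n (phi : box n N.+2) (psi : box m n) c :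
  in_obox (lift ord0 i) e phi -> extends phi c ->
  extends (box_comp phi psi) (act psi c).
Proof.
move=> phio cE; have [p|np] := pselect (in_obox i e (lower phi)).
  split=> [q|]; last first.
    by case: p => j [d [ne [y yE]]] []; exists j, d; split=> //;
      exists (box_comp y psi); rewrite lower_comp yE; apply: box_ext.
  have [K0 cK] := cE.1 p.
  have [L [aL _]] := bounded_ex (a n (exist _ _ p : obox i e n)).
  exists (K0 + L + bound c)%N => K KK v.
  have cst : stable_at (sval c) K by apply: stable_leq (boundP c) _; lia.
  have ast := stable_leq aL (_ : (L <= K)%N).
  rewrite (nerve_actE psi v cst) (cK K); last by lia.
  rewrite /= ext_comp; try exact/box_mono/svalP.
  have -> : exist _ _ q = obox_act psi (exist _ _ p : obox i e n).
    exact/obox_ext/box_ext.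
  rewrite (cfunP a psi) (nerve_actE psi v (ast _)) //; lia.
have [d phid] := lower_notin phio np.
rewrite (extends_const phid cE) act_const_cell.
have [c' c'E] := extends_ex (box_comp phi psi).
by have <- : c' = const_cell m x by apply: extends_const c'E => u; apply: phid.
Qed.

Definition obox_extension_cell n (phi : obox (lift ord0 i) e n) : nerve G n :=
  sval (cid (extends_ex (sval phi))).

Lemma obox_extensionP n (phi : obox (lift ord0 i) e n) :
  extends (sval phi) (obox_extension_cell phi).
Proof. exact: svalP (cid _). Qed.

Lemma obox_extension_act m n (psi : box m n) (phi : obox (lift ord0 i) e n) :
  obox_extension_cell (act psi phi) = act psi (obox_extension_cell phi).
Proof.
apply: extends_uniq (obox_extensionP _) _.
by apply: extends_act (obox_extensionP _); apply: svalP phi.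
Qed.

Definition obox_extension : cmap (obox (lift ord0 i) e) (nerve G) :=
  CMap obox_extension_act.
End ExtendOpenBox.

Section Yoneda.
Variables (X : cset) (n : nat) (z : X n).

Lemma yoneda_act m k (phi : box m k) (psi : box k n) :
  act (box_comp psi phi) z = act phi (act psi z).
Proof. exact: act_comp. Qed.

Definition yoneda : cmap (rep n) X :=
  @CMap (rep n) X (fun m (phi : box m n) => act phi z) yoneda_act.
End Yoneda.

Lemma cmap_rep (X : cset) n (b : cmap (rep n) X) m (phi : box m n) :
  b m phi = act phi (b n (box_id n)).
Proof. by rewrite -cfunP; congr (b m _); apply: box_ext. Qed.

Lemma uncurry_cell_post n (G H : pgraph) (f : pmap G H)
    (z : nerve (loop G) n) :
  nerve_map f _ (uncurry_cell z) = uncurry_cell (nerve_map (loop_fmap f) _ z).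
Proof. exact: ncell_ext. Qed.

Lemma ext_face_lift n K (j : 'I_n.+1) d v :
  ext K (@face n.+1 (lift ord0 j) d) v ord0 = clamp K v ord0.
Proof.
have /(congr1 (fun h => h ord0)) := insertK (lift ord0 j)
  (if d then K%:Z else - K%:Z) (clamp K v).
rewrite ext_face /delete => <-; congr (insert _ _ _ _); exact: val_inj.
Qed.

Section LoopFibration.
Variables (G H : pgraph) (f : pmap G H).

Lemma obox_extension_post N (i : 'I_N.+1) e
    (a : cmap (obox i e) (nerve (loop G)))
    (b : cmap (rep N.+1) (nerve (loop H))) :
  (forall n (y : obox i e n),
     nerve_map (loop_fmap f) n (a n y) = b n (obox_incl i e n y)) ->
  forall n (phi : obox (lift ord0 i) e n),
    nerve_map f n (obox_extension a n phi) =
    act (sval phi) (uncurry_cell (b _ (box_id N.+1))).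
Proof.
move=> ab n phi; set z := b _ _; have [K0 zK] := bounded_ex z.
have cE := obox_extensionP a phi; apply: ncell_ext => v.
have [p|np] := pselect (in_obox i e (lower (sval phi))).
  have [K1 cK] := cE.1 p; pose K := maxn K0 K1.
  rewrite (act_uncurry_cell _ _ (bounded_leq zK (leq_maxl K0 K1))) -cmap_rep.
  rewrite -(ab n (exist _ _ p : obox i e n)) /= /obox_extension_cell.
  by rewrite (cK _ (leq_maxr K0 K1)).
have [d phid] : exists d, forall u, sval (sval phi) u ord0 = d.
  exact: lower_notin (svalP phi) np.
have -> : obox_extension a n phi = const_cell n (pt G).
  exact: extends_const phid cE.
rewrite (act_uncurry_cell _ _ zK) (ext_const _ _ phid) /= pfunP.
have [L [_ zL]] := bounded_ex (act (lower (sval phi)) z).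
by rewrite zK.2 //; case: d {phid}; lia.
Qed.

(** The loop coordinate is an extra dimension. An open box in the nerve of the
    loop graph is an open box of [G] of one dimension more, whose faces in the
    loop direction are constant; a filler has these faces, so it is a cube of
    loops. *)
Lemma loop_fibration : fibration f -> fibration (loop_fmap f).
Proof.
move=> fk N i e a b ab.
have [l [la lb]] := fk _ (lift ord0 i) e (obox_extension a)
  (yoneda (uncurry_cell (b _ (box_id N.+1)))) (obox_extension_post ab).
pose w := l _ (box_id N.+2).
have wface j d : (j, d) <> (lift ord0 i, e) ->
    extends a (box_face j d) (act (box_face j d) w).
  move=> ne; have fP : in_obox (lift ord0 i) e (box_face j d).
    by exists j, d; split=> //; exists (box_id _); apply: box_ext.
  suff -> : act (box_face j d) w = obox_extension a _ (exist _ _ fP).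
    exact: (obox_extensionP a (exist _ _ fP)).
  by rewrite -la -cmap_rep.
have [z zE] : exists z : nerve (loop G) N.+1, uncurry_cell z = w.
  apply: curry_cell => d.
  apply: (extends_const _ (wface ord0 d _)) => // u.
  by rewrite /= /face insert_at.
exists (yoneda z); split=> [n [y yP]|n phi].
- have [j [d [ne [y0 yE]]]] := yP.
  have fP : in_obox i e (box_face j d).
    by exists j, d; split=> //; exists (box_id N); apply: box_ext.
  suff zface : act (box_face j d) z = a _ (exist _ _ fP : obox i e N).
    have -> : exist _ y yP = obox_act y0 (exist _ _ fP : obox i e N).
      exact: obox_ext.
    by rewrite (cfunP a y0) -zface; apply: (@act_comp (nerve (loop G))).
  have [|cE _] := wface (lift ord0 j) d.
    by case=> ji di; apply: ne; rewrite di; congr (_, _); apply: val_inj.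
  (* Both cubes of loops are compared after uncurrying, on the face
     [lift ord0 j], where the filler is prescribed by [a]. *)
  have lP : in_obox i e (lower (box_face (lift ord0 j) d)).
    by exists j, d; split=> //; exists (box_degen ord0); rewrite lower_face.
  have [K0 cK] := cE lP; have [K1 zK] := bounded_ex z.
  apply: ncell_ext => v; apply: loop_ext => t.
  pose K := (K0 + K1 + `|t : int|)%N.
  pose u : gpow Iinf N.+1 := insert ord0 t v.
  have ut : ext K (sval (box_face (lift ord0 j) d)) u ord0 = t.
    by rewrite ext_face_lift /clamp /u insert_at /K; lia.
  transitivity (sval (act (box_face (lift ord0 j) d) w) u).
    rewrite -zE (act_uncurry_cell _ _ (bounded_leq zK (_ : (K1 <= K)%N))).
      by rewrite ut lower_face act_comp nerve_degen insertK.
    by rewrite /K; lia.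
  rewrite (cK K) ?ut; last by rewrite /K; lia.
  have -> : exist _ _ lP =
      obox_act (box_degen ord0) (exist _ _ fP : obox i e N).
    by apply: obox_ext; rewrite /= lower_face.
  by rewrite (cfunP a (box_degen ord0)) nerve_degen insertK.
- rewrite [RHS]cmap_rep [LHS](nerve_postP (loop_fmap f) phi z).
  congr (act phi _).
  apply: uncurry_cell_inj.
  rewrite -[LHS](uncurry_cell_post f) zE.
  by rewrite [LHS](lb _ (box_id _)) /= nerve_act_id.
Qed.
End LoopFibration.

(** * Pullbacks and the terminal object *)

Section Pullback.
Variables (P X E B : pgraph).
Variables (a : pmap P X) (e : pmap P E) (f : pmap X B) (p : pmap E B).
Hypothesis pb : is_pullback a e f p.

Let Q_rel (s t : {s : X * E | f s.1 = p s.2}) : Prop :=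
  adj (sval s).1 (sval t).1 /\ adj (sval s).2 (sval t).2.
Let Q_sym s t : Q_rel s t -> Q_rel t s.
Proof. by case=> /adj_sym ? /adj_sym. Qed.
Let Q : graph := graph_of_rel Q_sym.
Let Q_adj (s t : Q) : adj s t <-> Q_rel s t.
Proof. by apply: adj_of_rel => u; split; left. Qed.
Let Q_pt : f (pt X) = p (pt E).
Proof. by rewrite !pfunP. Qed.
Let pQ : pgraph := @PGraph Q (exist _ (pt X, pt E) Q_pt).

Let fst_adj (s t : pQ) : adj s t -> adj (sval s).1 (sval t).1.
Proof. by case/Q_adj. Qed.
Let snd_adj (s t : pQ) : adj s t -> adj (sval s).2 (sval t).2.
Proof. by case/Q_adj. Qed.
Let pfst : pmap pQ X := @PMap pQ X (GMap fst_adj) erefl.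
Let psnd : pmap pQ E := @PMap pQ E (GMap snd_adj) erefl.

Let square z : f (a z) = p (e z).
Proof. exact: (congr1 (fun h : pmap P B => h z) pb.1). Qed.

Let to_Q_fun (z : P) : pQ := exist _ (a z, e z) (square z).
Let to_Q_adj z t : adj z t -> adj (to_Q_fun z) (to_Q_fun t).
Proof. by move=> zt; apply/Q_adj; split; apply: gfunP. Qed.
Let to_Q_pt : GMap to_Q_adj (pt P) = pt pQ.
Proof.
suff eq_Q (s t : pQ) : sval s = sval t -> s = t.
  by apply: eq_Q; rewrite /= !pfunP.
case: s t => [s sP] [t tP] /= st; subst t.
by congr exist; apply: Prop_irrelevance.
Qed.
Let to_Q : pmap P pQ := PMap to_Q_pt.

(** The pointed graph [pQ] of compatible pairs with componentwise adjacency is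
    itself a pullback, hence isomorphic to [P]. *)
Lemma pullback_iso : exists u : pmap pQ P,
  [/\ pcomp a u = pfst, pcomp e u = psnd & forall z, u (to_Q z) = z].
Proof.
have sq : pcomp f pfst = pcomp p psnd by apply: pmap_ext => -[].
have [u [[au eu] _]] := pb.2 _ pfst psnd sq.
exists u; split=> // z; have [w [_ w_uniq]] := pb.2 _ a e pb.1.
have /(congr1 (fun h : pmap P P => h z)) : pcomp u to_Q = pid P; last by [].
rewrite -(w_uniq (pid P)) ?(w_uniq (pcomp u to_Q)) //;
  split; apply: pmap_ext => t //.
  exact: (congr1 (fun h : pmap pQ X => h (to_Q t)) au).
exact: (congr1 (fun h : pmap pQ E => h (to_Q t)) eu).
Qed.

Lemma pullback_point x y : f x = p y -> exists z, a z = x /\ e z = y.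
Proof.
move=> xy; have [u [au eu _]] := pullback_iso.
exists (u (exist _ (x, y) xy)); split.
  exact: (congr1 (fun h : pmap pQ X => h (exist _ (x, y) xy)) au).
exact: (congr1 (fun h : pmap pQ E => h (exist _ (x, y) xy)) eu).
Qed.

Lemma pullback_adj z t : adj (a z) (a t) -> adj (e z) (e t) -> adj z t.
Proof.
move=> azt ezt; have [u [_ _ uK]] := pullback_iso.
by rewrite -(uK z) -(uK t); apply: gfunP; apply/Q_adj.
Qed.

Lemma pullback_eq z t : a z = a t -> e z = e t -> z = t.
Proof.
move=> azt ezt; have [u [_ _ uK]] := pullback_iso.
rewrite -(uK z) -(uK t); congr (u _).
have : sval (to_Q z) = sval (to_Q t) by rewrite /= azt ezt.
case: (to_Q z) (to_Q t) => [s sP] [r rP] /= sr; subst r.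
by congr exist; apply: Prop_irrelevance.
Qed.

Lemma loop_pullback :
  is_pullback (loop_fmap a) (loop_fmap e) (loop_fmap f) (loop_fmap p).
Proof.
split; first by rewrite -!loop_fmap_comp pb.1.
move=> Z x y xy.
have fxpy t i : f (loop_map (x t) i) = p (loop_map (y t) i).
  have /(congr1 (fun h : pmap Z (loop B) => loop_map (h t) i)) := xy; exact.
have /choice[k kP] (ti : Z * Iinf) : exists z,
    a z = loop_map (x ti.1) ti.2 /\ e z = loop_map (y ti.1) ti.2.
  exact: pullback_point (fxpy _ _).
have k_pt t i : loop_map (x t) i = pt X -> loop_map (y t) i = pt E ->
    k (t, i) = pt P.
  by have [ka ke] := kP (t, i); move=> xt yt;
    apply: pullback_eq; rewrite pfunP ?ka ?ke.
have k_adj t i j : adj i j -> adj (k (t, i)) (k (t, j)).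
  move=> ij; have [[ka ke] [ka' ke']] := (kP (t, i), kP (t, j)).
  by apply: pullback_adj; rewrite ?ka ?ke ?ka' ?ke'; apply: gfunP.
have k_left t : left_end (GMap (k_adj t)) (pt P).
  have [[M xM] [N yN]] := (loop_left (x t), loop_left (y t)).
  by exists (M + N)%N => i iN; apply: k_pt; [apply: xM|apply: yN]; lia.
have k_right t : right_end (GMap (k_adj t)) (pt P).
  have [[M xM] [N yN]] := (loop_right (x t), loop_right (y t)).
  by exists (M + N)%N => i iN; apply: k_pt; [apply: xM|apply: yN]; lia.
pose u_fun t : loop P := mk_loop (k_left t) (k_right t).
have u_adj t s : adj t s -> adj (u_fun t) (u_fun s).
  move=> ts; apply/adj_loop => i /=.
  have [[ka ke] [ka' ke']] := (kP (t, i), kP (s, i)).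
  by apply: pullback_adj; rewrite ?ka ?ke ?ka' ?ke';
    apply/(adj_loop _ _).1/gfunP.
have u_pt : GMap u_adj (pt Z) = pt (loop P).
  by apply: loop_ext => i /=; apply: k_pt; rewrite pfunP.
exists (PMap u_pt); split.
  by split; apply: pmap_ext => t; apply: loop_ext => i; have [] := kP (t, i).
move=> w [wx wy]; apply: pmap_ext => t; apply: loop_ext => i.
have [ka ke] := kP (t, i); apply: pullback_eq => /=.
  by rewrite ka -wx.
by rewrite ke -wy.
Qed.
End Pullback.

Lemma loop_terminal (T : pgraph) : is_terminal T -> is_terminal (loop T).
Proof.
move=> Tt; have all_pt (z : T) : z = pt T.
  have c : gconst T (pt T) (pt T) = pt T by [].
  have [h [_ h_uniq]] := Tt T.
  have := h_uniq (pid T) I; rewrite (h_uniq (PMap c) I).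
  by move=> /(congr1 (fun h : pmap T T => h z)) /esym.
move=> G; have c : gconst G (pt (loop T)) (pt G) = pt (loop T) by [].
exists (PMap c); split=> // h _; apply: pmap_ext => z; apply: loop_ext => i.
by rewrite [RHS]all_pt; apply: all_pt.
Qed.

Theorem theorem5p27 : exact_functor loop_functor.
Proof.
split=> [G H f|G H f [fk fw]|P X E B a e f p _|T].
- exact: loop_fibration.
- by split; [apply: loop_fibration|apply: loop_weak_equivalence].
- exact: loop_pullback.
- exact: loop_terminal.
Qed.
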